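(* Let $x>0$ be fixed and let $(\kappa_n)_{n\geqslant 1}$ be a strictly increasing sequence of integers with $\lim_{n\to\infty}\frac{\kappa_n}{n}=x$. Then, almost surely, $$\lim_{N\to\infty}\frac{1}{\log N}\sum_{n=1}^N 1_{\{T_n=\kappa_n\}}=e^{-\gamma}\rho(x).$$
   Context: $\gamma$ is the Euler--Mascheroni constant. $\rho$ is the Dickman function: the continuous function on $[0,+\infty)$ with $\rho(x)=1$ for $0\leqslant x\leqslant 1$ and $x\rho'(x)+\rho(x-1)=0$ for $x>1$. $(Z_k)_{k\geqslant 1}$ are independent random variables (on a common probability space) with $P(Z_k=1)=\frac1k$ and $P(Z_k=0)=1-\frac1k$ for each $k$, and $T_n=\sum_{k=1}^n kZ_k$. *)

(* Defs.v *)
From HB Require Import structures.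
From mathcomp Require Import all_boot all_order all_algebra finmap.
From mathcomp Require Import all_classical all_reals all_analysis.
Set Implicit Arguments.
Unset Strict Implicit.
Unset Printing Implicit Defensive.
Import Order.TTheory GRing.Theory Num.Theory.
Import numFieldTopology.Exports numFieldNormedType.Exports.
Local Open Scope classical_set_scope.
Local Open Scope ring_scope.

(* [series harmonic n] is 1 + 1/2 + ... + 1/n. *)
Definition euler_mascheroni (R : realType) : R :=
  lim ((fun n : nat => series (@harmonic R) n - ln n%:R) @ \oo).

(* The values of [rho] on negative reals are irrelevant; on [0, +oo[ these
   conditions determine [rho] uniquely. *)
Definition is_dickman (R : realType) (rho : R -> R) : Prop :=
  [/\ {within `[0, +oo[, continuous rho},
      (forall x : R, 0 <= x <= 1 -> rho x = 1) &
      (forall x : R, 1 < x ->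
         derivable rho x 1 /\ x * derive1 rho x + rho (x - 1) = 0)].

(* Mutual independence of the random variables [X i] for [i] in [D]. *)
Definition independent_RVs d (Omega : measurableType d) (R : realType)
    (P : probability Omega R) (I : choiceType) (D : set I)
    (X : I -> {RV P >-> R}) : Prop :=
  forall (J : {fset I}) (A : I -> set R),
    [set` J] `<=` D -> (forall i, measurable (A i)) ->
    P (\bigcap_(i in [set` J]) (X i @^-1` A i)) =
    (\prod_(i <- J) P (X i @^-1` A i))%E.

Definition weighted_sum d (Omega : measurableType d) (R : realType)
    (P : probability Omega R) (Z : nat -> {RV P >-> R}) (n : nat)
    (w : Omega) : R :=
  \sum_(1 <= k < n.+1) k%:R * Z k w.

(* Main.v *)
Require Import Defs.
From HB Require Import structures.
From mathcomp Require Import all_boot all_order all_algebra finmap.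
From mathcomp Require Import all_classical all_reals all_analysis.
From mathcomp Require Import measurable_realfun ring lra zify.
Set Implicit Arguments.
Unset Strict Implicit.
Unset Printing Implicit Defensive.
Import Order.TTheory GRing.Theory Num.Theory.
Import numFieldTopology.Exports numFieldNormedType.Exports.
Local Open Scope classical_set_scope.
Local Open Scope ring_scope.

(* Let pgf m n = \prod_(m < k <= n) (1 - 1/k + X^k/k), so that the coefficients
   of pgf 0 n are P(T_n = j) and those of pgf m n are P(T_n - T_m = j).

   Local limit theorem: n P(T_n = m) -> e^-gamma rho(m / n) uniformly for m in
   [M, K n].  For m <= n the quantity n P(T_n = m) does not depend on n.  Summing
   X F'(X) = \sum_k X^k F(X)/(1 - 1/k + X^k/k) over coefficients shows that this
   diagonal sequence is almost equal to its own running mean, hence converges, and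
   Abel summation against \prod_k e^(z^k / k) identifies its limit as e^-gamma.
   For m > n one descends from n = m through the exact recurrence
     (n+1) P(T_(n+1) = m) = n P(T_n = m) + P(T_n = m - n - 1),
   a discretisation of x rho'(x) + rho(x - 1) = 0.

   Decorrelation: the same identity for pgf m n gives j P(T_n - T_m = j) as a window
   sum up to O(1/m), so these probabilities vary slowly in j and the covariance of
   {T_m = kappa_m} and {T_n = kappa_n} is at most C (1/n^2 + 1/(m^2 n)).  The variance
   of the number of hits up to N is then O(ln N); Chebyshev and Borel-Cantelli along
   N = 2^((j+1)^4), and monotonicity in between, conclude. *)

(** * Generating functions of the partial sums *)

Definition pgf_factor (R : realFieldType) (k : nat) : {poly R} :=
  (1 - k%:R^-1)%:P + k%:R^-1 *: 'X^k.

Definition pgf (R : realFieldType) (m n : nat) : {poly R} :=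
  \prod_(m.+1 <= k < n.+1) pgf_factor R k.

(** For m < i <= n this is the quotient of [pgf R m n] by its factor i, obtained without polynomial
    division. *)
Definition pgf_omit (R : realFieldType) (m n i : nat) : {poly R} :=
  \prod_(m.+1 <= k < n.+1 | k != i) pgf_factor R k.

Section pgf_algebra.
Variable R : realFieldType.
Implicit Types (m n i j k : nat) (p q : {poly R}).

Local Notation factor := (pgf_factor R).
Local Notation F := (pgf R).
Local Notation Fo := (pgf_omit R).

Lemma invn_le1 k : k%:R^-1 <= 1 :> R.
Proof.
by case: k => [|k]; rewrite ?invr0// invf_le1 ?ltr0Sn// ler1n.
Qed.

Definition nneg_poly p := forall j, 0 <= p`_j.

Lemma nneg_polyM p q : nneg_poly p -> nneg_poly q -> nneg_poly (p * q).
Proof. by move=> p0 q0 j; rewrite coefM sumr_ge0// => i _; rewrite mulr_ge0. Qed.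

Lemma nneg_polyXn k : nneg_poly 'X^k.
Proof. by move=> j; rewrite coefXn. Qed.

Lemma pgf_factor_nneg k : nneg_poly (factor k).
Proof.
move=> j; rewrite coefD coefC coefZ coefXn addr_ge0 ?mulr_ge0 ?invr_ge0//.
by case: ifP => // _; rewrite subr_ge0 invn_le1.
Qed.

Lemma pgf_prod_nneg m n (Q : pred nat) :
  nneg_poly (\prod_(m <= k < n | Q k) factor k).
Proof.
apply: (big_ind nneg_poly) => [j|p q|k _].
- by rewrite coef1.
- exact: nneg_polyM.
- exact: pgf_factor_nneg.
Qed.

Lemma pgf_nneg m n : nneg_poly (F m n).
Proof. exact: pgf_prod_nneg. Qed.

Lemma pgf_omit_nneg m n i : nneg_poly (Fo m n i).
Proof. exact: pgf_prod_nneg. Qed.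

Lemma nneg_coefMXn_ge0 p j k : nneg_poly p -> 0 <= (p * 'X^k)`_j.
Proof. by move=> p0; apply: nneg_polyM => //; exact: nneg_polyXn. Qed.

Lemma pgf_coef_ge0 m n j : 0 <= (F m n)`_j.
Proof. exact: pgf_nneg. Qed.

Lemma pgf_factor_horner1 k : (factor k).[1] = 1.
Proof. by rewrite !hornerE expr1n mulr1 subrK. Qed.

Lemma pgf_horner1 m n : (F m n).[1] = 1.
Proof.
by rewrite horner_prod big1// => k _; exact: pgf_factor_horner1.
Qed.

Lemma pgfnn m : F m m = 1.
Proof. by rewrite /pgf big_geq. Qed.

Lemma pgfS m n : (m <= n)%N -> F m n.+1 = F m n * factor n.+1.
Proof. by move=> mn; rewrite /pgf big_nat_recr. Qed.

Lemma pgf_cat l m n : (l <= m)%N -> (m <= n)%N -> F l n = F l m * F m n.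
Proof. by move=> lm mn; rewrite /pgf (@big_cat_nat _ _ _ m.+1). Qed.

(** Multiplied by n + 1, the new factor is n + X^(n+1). *)
Lemma pgfS_coef m n j : (m <= n)%N ->
  n.+1%:R * (F m n.+1)`_j = n%:R * (F m n)`_j + (F m n * 'X^(n.+1))`_j.
Proof.
move=> mn; rewrite pgfS// mulrDr coefD coefMC -scalerAr coefZ.
have n0 : n.+1%:R != 0 :> R by rewrite pnatr_eq0.
by move: n0; rewrite -!natr1 => n0; field.
Qed.

Lemma sum_uniq_le (f : nat -> R) (s : seq nat) N :
  (forall i, 0 <= f i) -> uniq s -> {in s, forall i, (i < N)%N} ->
  \sum_(i <- s) f i <= \sum_(i < N) f i.
Proof.
move=> f0 us sN; rewrite -(big_mkord xpredT f).
rewrite (perm_big [seq i <- index_iota 0 N | i \in s]); last first.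
  apply: uniq_perm => //; first by rewrite filter_uniq ?iota_uniq.
  by move=> i; rewrite mem_filter mem_index_iota; case: (boolP (i \in s)) => // /sN ->.
rewrite big_filter big_mkcond/=; apply: ler_sum => i _.
by case: ifP.
Qed.

Lemma horner1_wide p N : (size p <= N)%N -> p.[1] = \sum_(i < N) p`_i.
Proof.
by move=> pN; rewrite (horner_coef_wide _ pN); apply: eq_bigr => i _; rewrite expr1n mulr1.
Qed.

(** For c > 0 the indices j - c k are distinct, so each nonnegative coefficient of p is collected at
    most once, and p(1) is the sum of them all. *)
Lemma sum_coefMXn_le p j c m n : nneg_poly p -> (0 < c)%N ->
  \sum_(m <= k < n) (p * 'X^(c * k))`_j <= p.[1].
Proof.
move=> p0 c0.
under eq_bigr do rewrite coefMXn.
rewrite (eq_bigr (fun k => if (c * k <= j)%N then p`_(j - c * k) else 0)); last first.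
  by move=> k _; rewrite ltnNge; case: (c * k <= j)%N.
rewrite -big_mkcond/= -big_filter -(big_map (fun k => j - c * k)%N xpredT (fun i => p`_i)).
rewrite (@horner1_wide _ (maxn (size p) j.+1)) ?leq_maxl//.
apply: sum_uniq_le.
- exact: p0.
- rewrite map_inj_in_uniq ?filter_uniq ?iota_uniq// => a b.
  rewrite !mem_filter => /andP[ca _] /andP[cb _] /(congr1 (fun t => j - t)%N).
  by rewrite !subKn// => /eqP; rewrite eqn_pmul2l// => /eqP.
- move=> i /mapP[k _ ->]; rewrite leq_max; apply/orP; right; lia.
Qed.

Lemma pgf_coef_le1 m n j : (F m n)`_j <= 1.
Proof.
have := sum_coefMXn_le j 0 1 (pgf_nneg m n) (isT : (0 < 1)%N).
by rewrite big_nat1 muln0 expr0 mulr1 pgf_horner1.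
Qed.

Lemma pgf_omitE m n k : (m < k <= n)%N ->
  F m n = (1 - k%:R^-1) *: Fo m n k + k%:R^-1 *: (Fo m n k * 'X^k).
Proof.
move=> mkn; rewrite /pgf (bigD1_seq k) ?iota_uniq ?mem_index_iota//=.
by rewrite -/(Fo m n k) mulrDl mul_polyC -scalerAl mulrC [in X in _ + X]mulrC.
Qed.

Lemma pgf_omitS m n k : (m <= n)%N -> (k <= n)%N ->
  Fo m n.+1 k = Fo m n k * factor n.+1.
Proof.
move=> mn kn; rewrite /pgf_omit big_mkcond big_nat_recr//= -big_mkcond/=.
by rewrite ifT// gtn_eqF.
Qed.

Lemma pgf_omit_last m n : (m <= n)%N -> Fo m n.+1 n.+1 = F m n.
Proof.
move=> mn; rewrite /pgf_omit big_mkcond big_nat_recr//= eqxx mulr1.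
by apply: eq_big_nat => i /andP[_ ?]; rewrite ifT// ltn_eqF.
Qed.

(** X times the derivative of factor k is X^k, so the product rule replaces one factor at a time by
    X^k. *)
Lemma pgf_derivX m n : (m <= n)%N ->
  (F m n)^`() * 'X = \sum_(m.+1 <= k < n.+1) Fo m n k * 'X^k.
Proof.
elim: n => [|n IH]; first by rewrite leqn0 => /eqP ->; rewrite pgfnn derivC mul0r big_geq.
rewrite leq_eqVlt => /predU1P[->|mn]; first by rewrite pgfnn derivC mul0r big_geq.
rewrite pgfS// derivM mulrDl mulrAC IH// [in RHS]big_nat_recr//= pgf_omit_last//.
rewrite mulr_suml; congr (_ + _).
  by apply: eq_big_nat => k /andP[_ kn]; rewrite pgf_omitS// mulrAC.
rewrite -mulrA; congr (_ * _).
rewrite /pgf_factor derivD derivC add0r derivZ derivXn /= -scalerAl mulrnAl -exprSr.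
by rewrite -[X in _ *: X]scaler_nat scalerA mulVf ?scale1r// pnatr_eq0.
Qed.

Lemma pgf_coefM m n j : (m <= n)%N ->
  j%:R * (F m n)`_j = \sum_(m.+1 <= k < n.+1) (Fo m n k * 'X^k)`_j.
Proof.
move=> mn; rewrite -coef_sum -pgf_derivX// coefMX coef_deriv.
by case: j => [|j]/=; rewrite ?mul0r// mulr_natl.
Qed.

(** For k >= 2 the constant term 1 - 1/k of the omitted factor is at least 1/2, and its other term
    contributes nonnegatively. At k = 1 that constant term vanishes. *)
Lemma pgf_omit_le m n k j i : (1 < k)%N -> (m < k <= n)%N ->
  (Fo m n k * 'X^i)`_j <= 2 * (F m n * 'X^i)`_j.
Proof.
move=> k1 mkn; rewrite (pgf_omitE mkn) [(_ + _) * 'X^i]mulrDl -!scalerAl coefD !coefZ -mulrA -exprD.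
have f0 : 0 <= (Fo m n k * 'X^i)`_j by apply/nneg_coefMXn_ge0/pgf_omit_nneg.
have g0 : 0 <= (Fo m n k * 'X^(k + i))`_j by apply/nneg_coefMXn_ge0/pgf_omit_nneg.
have k2 : k%:R^-1 <= 2^-1 :> R by rewrite lef_pV2 ?posrE ?ltr0n ?ler_nat//; lia.
have k0 : 0 <= k%:R^-1 :> R by [].
nra.
Qed.

(** Factor k differs from 1 by (X^k - 1)/k, so restoring it changes the polynomial by 1/k times
    shifts of [pgf_omit], which [pgf_omit_le] compares with [pgf]. *)
Lemma pgf_omit_approx m n k j : (1 < k)%N -> (m < k <= n)%N ->
  `|(Fo m n k * 'X^k)`_j - (F m n * 'X^k)`_j| <=
  2 * k%:R^-1 * ((F m n * 'X^(1 * k))`_j + (F m n * 'X^(2 * k))`_j).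
Proof.
move=> k1 mkn; have h1 := pgf_omit_le j (1 * k) k1 mkn.
have h2 := pgf_omit_le j (2 * k) k1 mkn.
have f1 : 0 <= (Fo m n k * 'X^(1 * k))`_j by apply/nneg_coefMXn_ge0/pgf_omit_nneg.
have f2 : 0 <= (Fo m n k * 'X^(2 * k))`_j by apply/nneg_coefMXn_ge0/pgf_omit_nneg.
have k0 : 0 <= k%:R^-1 :> R by [].
have -> : (Fo m n k * 'X^k)`_j - (F m n * 'X^k)`_j =
    k%:R^-1 * ((Fo m n k * 'X^(1 * k))`_j - (Fo m n k * 'X^(2 * k))`_j).
  rewrite (pgf_omitE mkn) mulrDl -!scalerAl coefD !coefZ -mulrA -exprD.
  by rewrite addnn -mul2n mul1n; ring.
rewrite normrM ger0_norm// (mulrC 2) -mulrA; apply: ler_wpM2l => //.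
by rewrite ler_norml; apply/andP; split; lra.
Qed.

(** Factor 1 is X, since Z_1 = 1 almost surely. This handles the term k = 1, out of reach of
    [pgf_omit_le]. *)
Lemma pgf0E n : (0 < n)%N -> F 0 n = Fo 0 n 1 * 'X^1.
Proof.
by move=> n0; rewrite (@pgf_omitE 0 n 1)// invr1 subrr scale0r add0r scale1r.
Qed.

(** In [pgf_coefM] the terms k >= 2 are at most twice distinct coefficients of [pgf], hence at most
    2 in total; when m = 0 the term k = 1 is a single coefficient, at most 1. *)
Lemma mul_pgf_coef_le3 m n j : (m <= n)%N -> j%:R * (F m n)`_j <= 3.
Proof.
move=> mn; rewrite pgf_coefM//.
have main l : (m <= l)%N -> (0 < l)%N ->
    \sum_(l.+1 <= k < n.+1) (Fo m n k * 'X^k)`_j <= 2.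
  move=> ml l0; apply: (@le_trans _ _ (\sum_(l.+1 <= k < n.+1) 2 * (F m n * 'X^(1 * k))`_j)).
    by apply: ler_sum_nat => k /andP[lk kn]; rewrite mul1n; apply: pgf_omit_le; lia.
  rewrite -mulr_sumr ger_pMr//; have := sum_coefMXn_le j l.+1 n.+1 (pgf_nneg m n) (isT : (0 < 1)%N).
  by rewrite pgf_horner1.
case: m mn main => [|m] mn main; last by apply: le_trans (main m.+1 _ _) _ => //; lra.
case: n mn main => [|n] mn main; first by rewrite big_geq.
rewrite big_ltn// -pgf0E//.
by have := main 1 isT isT; have := pgf_coef_le1 0 n.+1 j; lra.
Qed.

Lemma pgf_coef_stable m n j : (m <= n)%N -> (j <= n)%N ->
  n.+1%:R * (F m n.+1)`_j = n%:R * (F m n)`_j.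
Proof. by move=> mn jn; rewrite pgfS_coef// coefMXn ltnS jn addr0. Qed.

(** As long as n <= j the quantity is at most j times the coefficient; beyond n = j it no longer
    depends on n. At j = 0 its value is m, by [pgf_coef0]. *)
Lemma mulr_pgf_coef_le3 m n j : (m <= n)%N -> (0 < j)%N -> n%:R * (F m n)`_j <= 3.
Proof.
move=> mn j0; elim: n mn => [|n IH].
  by rewrite mul0r.
rewrite leq_eqVlt => /predU1P[<-|mn].
  by rewrite pgfnn coef1 gtn_eqF// mulr0.
have [jn|nj] := leqP j n; first by rewrite pgf_coef_stable// IH.
apply: le_trans (mul_pgf_coef_le3 j (ltnW mn)).
by rewrite ler_wpM2r ?pgf_coef_ge0// ler_nat.
Qed.

Lemma pgf_coef0 m n : (m <= n)%N -> n%:R * (F m n)`_0 = m%:R.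
Proof.
elim: n => [|n IH]; first by rewrite leqn0 => /eqP ->; rewrite mul0r.
rewrite leq_eqVlt => /predU1P[<-|mn]; first by rewrite pgfnn coef1 mulr1.
by rewrite pgf_coef_stable// IH.
Qed.

Lemma pgf0_coef_le3 n j : n%:R * (F 0 n)`_j <= 3.
Proof.
case: j => [|j]; last exact: mulr_pgf_coef_le3.
by rewrite pgf_coef0.
Qed.

Lemma pgf0_coef_low n j : (j <= n)%N -> n%:R * (F 0 n)`_j = j%:R * (F 0 j)`_j.
Proof.
elim: n => [|n IH]; first by rewrite leqn0 => /eqP ->.
rewrite leq_eqVlt => /predU1P[->//|jn]; by rewrite pgf_coef_stable// IH.
Qed.

(** This is the mean of T_n - T_m: every k Z_k has mean 1. *)
Lemma pgf_mean m n : (m <= n)%N -> (F m n)^`().[1] = n%:R - m%:R.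
Proof.
move=> mn; have -> : (F m n)^`().[1] = ((F m n)^`() * 'X).[1] by rewrite hornerMX mulr1.
rewrite pgf_derivX// horner_sum.
rewrite (eq_bigr (fun=> 1)) => [|k _]; first by rewrite sumr_const_nat subSS natrB.
rewrite hornerM hornerXn expr1n mulr1 horner_prod big1// => i _; exact: pgf_factor_horner1.
Qed.

End pgf_algebra.

Lemma eq_cvgn (R : realType) (u v : R ^nat) (l : R) :
  u =1 v -> u @ \oo --> l -> v @ \oo --> l.
Proof. by move=> /funext ->. Qed.

(** * Convergence of the diagonal sequence n P(T_n = n) *)

Section pgf_diagonal.
Variable R : realType.
Implicit Types (m n i j k : nat).

Local Notation F := (pgf R).
Local Notation Fo := (pgf_omit R).

(* n P(T_n = n), which equals m P(T_m = n) for every m >= n. *)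
Definition pgf_diag n : R := n%:R * (F 0 n)`_n.

Lemma pgf_diag_ge0 n : 0 <= pgf_diag n.
Proof. by rewrite mulr_ge0// pgf_coef_ge0. Qed.

Lemma pgf_diag_le3 n : pgf_diag n <= 3.
Proof. exact: pgf0_coef_le3. Qed.

Lemma harmonic_series_ge1 n : (0 < n)%N -> 1 <= series (@harmonic R) n.
Proof.
case: n => // n _; rewrite seriesEnat/= big_nat_recl// invr1 lerDl.
by apply: sumr_ge0 => i _; rewrite invr_ge0.
Qed.

(** In [pgf_coefM] at j = n, replacing [pgf_omit] by [pgf] turns the sum over k into a sum of
    earlier diagonal values. After multiplication by n the replacement costs (2/k)(3 + 3) = 12/k per
    term, and the two boundary terms cost at most 6, absorbed by H_n >= 1. *)
Lemma pgf_diag_rec n : (0 < n)%N ->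
  `|n%:R * pgf_diag n - \sum_(j < n) pgf_diag j| <= 18 * series (@harmonic R) n.
Proof.
case: n => // n _; have H1 := harmonic_series_ge1 (ltn0Sn n).
set N := n.+1; rewrite {1}/pgf_diag (pgf_coefM R N (leq0n N)) big_ltn// -pgf0E//.
(* Here j = N - k: for j <= N the diagonal value at j is N times coefficient j of [pgf R 0 N]. The
   term j = N - 1, that is k = 1, is split off. *)
have -> : \sum_(j < N) pgf_diag j =
    pgf_diag n + N%:R * \sum_(2 <= k < N.+1) (F 0 N * 'X^k)`_N.
  rewrite big_ord_recr/= addrC; congr (_ + _).
  rewrite mulr_sumr -(big_mkord xpredT pgf_diag) big_nat_rev/= add0n.
  rewrite [RHS]big_add1 [RHS]big_add1; apply: eq_big_nat => k /andP[_ kn].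
  rewrite coefMXn ltnNge (_ : (k.+2 <= N)%N)//=.
  rewrite /pgf_diag -(@pgf0_coef_low R N) 1?(_ : n - k.+1 = N - k.+2)%N//.
  by rewrite leq_subr.
have := pgf_diag_le3 N; have := pgf_diag_le3 n; have := pgf_diag_ge0 N.
have := pgf_diag_ge0 n.
set s1 := \sum_(_ <= _ < _) _; set s2 := \sum_(_ <= _ < _) _.
suff : `|N%:R * (s1 - s2)| <= 12 * series (@harmonic R) N.
  rewrite /(pgf_diag N) => /ler_normlP[h1 h2] a0 a1 a2 a3.
  by apply/ler_normlP; split; lra.
rewrite normrM ger0_norm// -sumrB.
apply: le_trans (ler_wpM2l _ (ler_norm_sum _ _ _)) _ => //.
rewrite mulr_sumr seriesEnat/=.
have -> : \sum_(0 <= k < N) k.+1%:R^-1 = 1 + \sum_(2 <= k < N.+1) k%:R^-1 :> R.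
  by rewrite [RHS]addrC big_add1/= [LHS]big_ltn// invr1 addrC.
apply: (@le_trans _ _ (\sum_(2 <= k < N.+1) 12 * k%:R^-1)); last first.
  by rewrite -mulr_sumr ler_wpM2l// lerDr.
apply: ler_sum_nat => k /andP[k2 kN].
have kN' : (0 < k <= N)%N by lia.
have := pgf_omit_approx R N k2 kN'.
rewrite distrC => /(ler_wpM2l (ler0n R N))/le_trans; apply.
have := pgf0_coef_le3 R N; have := pgf_coef_ge0 R 0 N.
have b c : N%:R * (F 0 N * 'X^c)`_N <= 3.
  by rewrite coefMXn; case: ifP => _; rewrite ?mulr0// pgf0_coef_le3.
have := b (1 * k)%N; have := b (2 * k)%N.
set x := _`_N; set y := _`_N => bx byy _ _.
rewrite [leLHS](_ : _ = 2 * (N%:R * y + N%:R * x) * k%:R^-1); last by ring.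
by apply: ler_wpM2r => //; lra.
Qed.

Lemma cvg_harmonic_mean0 :
  (fun n => series (@harmonic R) n.+1 / n.+1%:R) @ \oo --> 0.
Proof.
rewrite (_ : (fun n => _) = arithmetic_mean (@harmonic R)).
  exact/cesaro/cvg_harmonic.
by apply/funext => n; rewrite /arithmetic_mean/= mulrC.
Qed.

(** The running mean v plus the vanishing correction 18 t is nonincreasing and nonnegative, so v
    converges; by [pgf_diag_rec] the sequence differs from its mean by O(H_n / n). *)
Lemma cvg_pgf_diag : exists L : R, pgf_diag @ \oo --> L.
Proof.
pose H := series (@harmonic R).
(* The decrement of t from n to n + 1 is at least H_(n+1) / ((n+1)(n+2)), which is what the error in
   [pgf_diag_rec] costs. The added 1 compensates the growth of H. *)
pose t n := (H n.+1 + 1) / n.+1%:R.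
pose S n := \sum_(j < n) pgf_diag j.
pose v n := S n.+1 / n.+1%:R.
have HS n : H n.+1 = H n + n.+1%:R^-1 by rewrite /H seriesEnat/= big_nat_recr.
have t0 : t @ \oo --> 0.
  rewrite (_ : t = (fun n => H n.+1 / n.+1%:R) + @harmonic R); last first.
    by apply/funext => n; rewrite /t mulrDl mul1r.
  by rewrite -[0]addr0; exact: cvgD cvg_harmonic_mean0 (@cvg_harmonic R).
have noninc : nonincreasing_seq (fun n => v n + 18 * t n).
  apply/nonincreasing_seqP => n.
  have := pgf_diag_rec (ltn0Sn n); rewrite -/(S n.+1) -/(H n.+1).
  rewrite /t (HS n.+1) /v.
  have -> : S n.+2 = S n.+1 + pgf_diag n.+1 by rewrite /S big_ord_recr.
  have h1 : n.+2%:R = n.+1%:R + 1 :> R by rewrite natr1.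
  have n0 : 0 < n.+1%:R :> R by rewrite ltr0n.
  move: n0; rewrite h1; move: (n.+1%:R) (pgf_diag n.+1) (S n.+1) (H n.+1) => x a s h x0.
  move=> /ler_normlP[_ ub]; rewrite -subr_ge0.
  rewrite [leRHS](_ : _ = (18 * (h + (x + 1)^-1) - (x * a - s)) / (x * (x + 1))); last by field; lra.
  apply: divr_ge0; last by nra.
  have : 0 <= (x + 1)^-1 by rewrite invr_ge0; lra.
  by lra.
have H0 n : 0 <= H n by rewrite /H seriesEnat/=; apply: sumr_ge0 => k _.
have [w wcvg] : exists w : R, (fun n => v n + 18 * t n) @ \oo --> w.
  exists (limn (fun n => v n + 18 * t n)); apply: nonincreasing_is_cvgn => //.
  exists 0 => _ [n _ <-]; rewrite addr_ge0//.
    by rewrite divr_ge0// sumr_ge0// => i _; exact: pgf_diag_ge0.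
  by rewrite mulr_ge0// divr_ge0// addr_ge0.
have vcvg : v @ \oo --> w.
  have h : (fun n => v n + 18 * t n - 18 * t n) @ \oo --> w - 18 * 0.
    by apply: cvgB => //; exact: cvgMl_tmp.
  by rewrite mulr0 subr0 in h; apply: eq_cvgn h => n; rewrite addrK.
exists w; rewrite -(cvg_shiftS pgf_diag).
apply: cvg_sub0 vcvg; apply: norm_cvg0.
apply: (@squeeze_cvgr _ _ _ _ (cst 0) (fun n => 18 * (H n.+1 / n.+1%:R))).
- near=> n; rewrite /= normr_ge0/=.
  have := pgf_diag_rec (ltn0Sn n); rewrite -/(S n.+1) -/(H n.+1) => h.
  have n0 : 0 < n.+1%:R :> R by rewrite ltr0n.
  rewrite mulrA ler_pdivlMr// -[X in _ * X]ger0_norm// -normrM.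
  by rewrite mulrDl mulNr divfK ?gt_eqF// mulrC.
- exact: cvg_cst.
- by rewrite -[0](mulr0 18); apply: cvgMl_tmp; exact: cvg_harmonic_mean0.
Unshelve. all: by end_near. Qed.

End pgf_diagonal.

(** * The constant e^-gamma *)

Lemma cvgnP_dist (R : realType) (u : R ^nat) (l : R) :
  u @ \oo --> l <->
  forall e, 0 < e -> exists N, forall n, (N <= n)%N -> `|u n - l| <= e.
Proof.
split=> [/cvgrPdist_le ul e e0|ul].
  by have [N _ NP] := ul _ e0; exists N => n /NP; rewrite distrC.
by apply/cvgrPdist_le => e /ul[N NP]; exists N => // n /NP; rewrite distrC.
Qed.

Section euler_constant.
Variable R : realType.
Implicit Types (m n i j k : nat) (z t : R).

Local Notation F := (pgf R).
Local Notation H := (series (@harmonic R)).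

(** Truncated Taylor series of -ln(1 - z). *)
Definition log_poly n : {poly R} := \sum_(1 <= k < n.+1) k%:R^-1 *: 'X^k.

Lemma log_polyS n : log_poly n.+1 = log_poly n + n.+1%:R^-1 *: 'X^(n.+1).
Proof. by rewrite /log_poly big_nat_recr. Qed.

Lemma log_poly0 : log_poly 0 = 0.
Proof. by rewrite /log_poly big_geq. Qed.

Lemma log_poly_at1 n : (log_poly n).[1] = H n.
Proof.
elim: n => [|n IH]; first by rewrite log_poly0 horner0 seriesEnat/= big_geq.
by rewrite log_polyS !hornerE IH expr1n mulr1 seriesEnat/= big_nat_recr.
Qed.

Lemma log_poly_deriv n z : (1 - z) * (log_poly n)^`().[z] = 1 - z ^+ n.
Proof.
elim: n => [|n IH]; first by rewrite log_poly0 linear0 horner0 mulr0 subrr.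
rewrite log_polyS derivD hornerD mulrDr IH derivZ derivXn/=.
rewrite hornerZ hornerMn hornerXn -[X in _ * (_ * X)]mulr_natl mulKf ?pnatr_eq0//.
by rewrite exprS; ring.
Qed.

(** The function E(t) = (1 - t) exp([log_poly n](t)) has derivative -t^n exp([log_poly n](t)), so it
    decreases from E(0) = 1. The upper bound, applied at the point c of the mean value theorem, then
    yields the lower one. *)
Lemma log_poly_exp_le n z : 0 <= z < 1 ->
  1 - z ^+ n / (1 - z) <= (1 - z) * expR (log_poly n).[z] <= 1.
Proof.
pose E t := (1 - t) * expR (log_poly n).[t].
pose dE t := - (expR (log_poly n).[t] * t ^+ n).
have dEP t : is_derive t (1 : R) E (dE t).
  have h1 : is_derive t (1 : R) (fun t => expR (log_poly n).[t])
      ((log_poly n)^`().[t] * expR (log_poly n).[t]).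
    by rewrite mulrC; exact: is_derive1_comp (is_derive_expR _) (is_derive_poly _ t).
  have h2 : is_derive t (1 : R) (fun t => 1 - t) (0 - 1).
    exact: is_deriveB (is_derive_cst (1 : R) t 1) (is_derive_id t 1).
  apply: (is_derive_eq (is_deriveM h2 h1)).
  rewrite /dE /GRing.scale/= mulrA log_poly_deriv sub0r mulrN1 mulrBl mul1r.
  by rewrite addrAC subrr sub0r mulrC.
have E0 : E 0 = 1.
  rewrite /E subr0 mul1r /log_poly horner_sum big_nat_cond big1 ?expR0// => k.
  by move=> /andP[/andP[k0 _] _]; rewrite hornerZ hornerXn expr0n gtn_eqF// mulr0.
have mvt z0 : 0 <= z0 -> exists2 c, 0 <= c <= z0 & E z0 = 1 + dE c * z0.
  move=> z00; have cE : {within `[0, z0], continuous E}.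
    by apply: derivable_within_continuous => x _; have [] := dEP x.
  have [c] := MVT_segment z00 (fun x _ => dEP x) cE.
  rewrite in_itv/= subr0 E0 => c0 /(congr1 (+%R^~ 1)).
  by rewrite subrK addrC => ->; exists c.
have E1 z0 : 0 <= z0 -> E z0 <= 1.
  move=> z00; have [c /andP[c0 _] ->] := mvt _ z00.
  by rewrite gerDl mulNr oppr_le0 mulr_ge0// mulr_ge0 ?expR_ge0// exprn_ge0.
move=> /andP[z0 z1]; rewrite -/(E z) E1// andbT.
have [c /andP[c0 cz] ->] := mvt _ z0.
rewrite lerD2l mulNr lerN2.
have z1' : 0 < 1 - z by rewrite subr_gt0.
have c1 : expR (log_poly n).[c] <= (1 - z)^-1.
  rewrite -[leRHS]mul1r ler_pdivlMr// mulrC; apply: le_trans (E1 c c0).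
  by rewrite ler_wpM2r ?expR_ge0// lerB.
rewrite mulrC [leRHS]mulrC -[leRHS]mul1r; apply: ler_pM => //.
- by rewrite mulr_ge0 ?expR_ge0// exprn_ge0.
- exact: ltW.
- by apply: ler_pM; rewrite ?expR_ge0 ?exprn_ge0// lerXn2r// nnegrE.
Qed.

(** This links the Abel sums of P(T_n = j) with e^-gamma: at z = 1 it equals n exp(-H_n) for n >
    0. *)
Definition euler_prod n z := n%:R * (F 0 n).[z] * expR (- (log_poly n).[z]).

Lemma pgfS_horner n z : n.+1%:R * (F 0 n.+1).[z] = (n%:R + z ^+ n.+1) * (F 0 n).[z].
Proof.
rewrite pgfS// hornerM /pgf_factor hornerD hornerC hornerZ hornerXn.
have n0 : n.+1%:R != 0 :> R by rewrite pnatr_eq0.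
by move: n0; rewrite -!natr1 => n0; field.
Qed.

Lemma pgf_horner_ge0 n z : 0 <= z -> 0 <= (F 0 n).[z].
Proof.
move=> z0; rewrite horner_coef sumr_ge0// => i _.
by rewrite mulr_ge0 ?exprn_ge0// pgf_coef_ge0.
Qed.

(** With t = z^(n+1), the inequality exp(-u) >= 1 - u reduces one step to (n + t)(1 - t/(n+1)) = n +
    t(1 - t)/(n+1) >= n. *)
Lemma euler_prod_nondecreasing m n z : 0 <= z <= 1 -> (m <= n)%N ->
  euler_prod m z <= euler_prod n z.
Proof.
move=> /andP[z0 z1]; move: m n; apply/nondecreasing_seqP => n.
rewrite /euler_prod pgfS_horner log_polyS hornerD opprD expRD hornerZ hornerXn.
have := pgf_horner_ge0 n z0; have := expR_ge0 (- (log_poly n).[z]).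
have := expR_ge1Dx (- (n.+1%:R^-1 * z ^+ n.+1)).
have := expR_ge0 (- (n.+1%:R^-1 * z ^+ n.+1)).
have : 0 <= z ^+ n.+1 <= 1 by rewrite exprn_ge0// exprn_ile1.
set e := expR (- (n.+1%:R^-1 * _)); set e' := expR _; set f := (F 0 n).[z].
move: (z ^+ n.+1) @e @e' @f => t e e' f; move: e e' f => e e' f /andP[t0 t1] e0 e1 e'0 f0.
suff : n%:R <= (n%:R + t) * e.
  move=> h; rewrite [leRHS](_ : _ = (n%:R + t) * e * (f * e')); last by ring.
  by rewrite -mulrA ler_wpM2r// mulr_ge0.
apply: le_trans (ler_wpM2l _ e1); last by rewrite addr_ge0.
have n0 : 0 < n.+1%:R :> R by [].
have -> : n%:R = n.+1%:R - 1 :> R by rewrite -natr1 addrK.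
move: (n.+1%:R) n0 => x x0; rewrite -subr_ge0.
rewrite [leRHS](_ : _ = x^-1 * (t * (1 - t))); last by field; lra.
by apply: mulr_ge0; [rewrite invr_ge0 ltW|rewrite mulr_ge0// subr_ge0].
Qed.

(** Factor k at z is 1 + (z^k - 1)/k, at most exp((z^k - 1)/k). *)
Lemma euler_prod_le_at1 n z : 0 <= z -> euler_prod n z <= euler_prod n 1.
Proof.
move=> z0; rewrite /euler_prod -!mulrA ler_wpM2l//.
rewrite (pgf_horner1 R 0 n) mul1r log_poly_at1.
suff h : (F 0 n).[z] <= expR ((log_poly n).[z] - H n).
  apply: le_trans (ler_wpM2r (expR_ge0 _) h) _.
  by rewrite -expRD addrAC subrr sub0r.
elim: n => [|n IH].
  by rewrite pgfnn hornerC log_poly0 horner0 seriesEnat/= big_geq// subrr expR0.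
rewrite pgfS// hornerM log_polyS hornerD hornerZ hornerXn.
have -> : H n.+1 = H n + n.+1%:R^-1 by rewrite seriesEnat/= big_nat_recr.
have -> : (log_poly n).[z] + n.+1%:R^-1 * z ^+ n.+1 - (H n + n.+1%:R^-1) =
  (log_poly n).[z] - H n + (n.+1%:R^-1 * z ^+ n.+1 - n.+1%:R^-1) by ring.
rewrite expRD; apply: ler_pM => //.
- exact: pgf_horner_ge0.
- rewrite /pgf_factor hornerD hornerC hornerZ hornerXn addr_ge0//.
    by rewrite subr_ge0 invn_le1.
  by rewrite mulr_ge0// exprn_ge0.
- rewrite /pgf_factor hornerD hornerC hornerZ hornerXn.
  by apply: le_trans (expR_ge1Dx _); rewrite -addrA [_^-1 * _ - _]addrC.
Qed.

Lemma euler_prod1E n : (0 < n)%N -> euler_prod n 1 = expR (ln n%:R - H n).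
Proof.
move=> n0; rewrite /euler_prod (pgf_horner1 R 0 n) mulr1 log_poly_at1 expRD lnK//.
by rewrite posrE ltr0n.
Qed.

Lemma harmonic_series_ge_ln n : n.+1%:R <= expR (H n).
Proof.
elim: n => [|n IH]; first by rewrite seriesEnat/= big_geq// expR0.
have -> : H n.+1 = H n + n.+1%:R^-1 by rewrite seriesEnat/= big_nat_recr.
rewrite expRD; apply: le_trans (ler_pM _ _ IH (expR_ge1Dx _)) => //.
  by rewrite mulrDr mulr1 divff ?pnatr_eq0// natr1.
Qed.

(** The constant is defined through [lim], so existence of the limit has to be proved: H_n - ln n is
    minus the logarithm of [euler_prod n 1], hence monotone. The index is shifted because [ln 0] is
    0, which breaks monotonicity at n = 0. *)
Lemma cvg_euler_mascheroni :
  (fun n => H n - ln n%:R) @ \oo --> euler_mascheroni R.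
Proof.
suff /cvg_ex[l] : cvgn (fun n => H n.+1 - ln n.+1%:R).
  by rewrite (cvg_shiftS (fun n => H n - ln n%:R)) => /cvgP.
apply: nonincreasing_is_cvgn.
  apply/nonincreasing_seqP => n.
  have : euler_prod n.+1 1 <= euler_prod n.+2 1.
    by apply: euler_prod_nondecreasing => //; rewrite ler01 lexx.
  by rewrite !euler_prod1E// ler_expR; lra.
exists 0 => _ [n _ <-]; rewrite subr_ge0 -ler_expR lnK ?posrE//.
by apply: le_trans (harmonic_series_ge_ln _); rewrite ler_nat.
Qed.

Lemma cvg_euler_prod1 :
  (fun n => euler_prod n 1) @ \oo --> expR (- euler_mascheroni R).
Proof.
rewrite -(cvg_shiftS (fun n => euler_prod n 1)).
apply: (@eq_cvgn _ (fun n => expR (- (H n.+1 - ln n.+1%:R)))).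
  by move=> n /=; rewrite euler_prod1E// opprB.
apply: continuous_cvg; first exact: continuous_expR.
apply: cvgN; rewrite (cvg_shiftS (fun n => H n - ln n%:R)).
exact: cvg_euler_mascheroni.
Qed.

Lemma euler_prod1_le n : euler_prod n 1 <= expR (- euler_mascheroni R).
Proof.
rewrite -(cvg_lim (@Rhausdorff R) cvg_euler_prod1).
apply: nondecreasing_cvgn_le; last by apply/cvg_ex; eexists; exact: cvg_euler_prod1.
by move=> a b; apply: euler_prod_nondecreasing; rewrite ler01 lexx.
Qed.

Lemma euler_prod1_le1 n : euler_prod n 1 <= 1.
Proof.
rewrite /euler_prod (pgf_horner1 R 0 n) mulr1 log_poly_at1 expRN.
rewrite ler_pdivrMr ?expR_gt0// mul1r.
by apply: le_trans (harmonic_series_ge_ln _); rewrite ler_nat.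
Qed.

Lemma euler_prod_cvg1 n : (fun z => euler_prod n z) @ 1^'- --> euler_prod n 1.
Proof.
apply: cvg_at_left_filter; apply: cvgM.
  by apply: cvgMl_tmp; exact: continuous_horner.
apply: continuous_cvg; first exact: continuous_expR.
by apply: cvgN; exact: continuous_horner.
Qed.

End euler_constant.

(** * Abel summation and identification of the diagonal limit *)

Section abel.
Variable R : realType.
Implicit Types (m n i j k : nat) (z t : R).

Local Notation F := (pgf R).

Lemma sum_geometric_telescope m n z : (m <= n)%N ->
  \sum_(m <= j < n) (1 - z) * z ^+ j = z ^+ m - z ^+ n.
Proof.
move=> mn; rewrite -[RHS]opprB -(telescope_sumr (fun j => z ^+ j) mn) -sumrN.
by apply: eq_bigr => j _; rewrite exprS; ring.
Qed.

(** The left side averages n P(T_n = j) - L with weights (1 - z) z^j. For M <= j <= n the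
    coefficient is a diagonal value, within eps of L; the indices j < M weigh at most M (1 - z),
    those beyond n at most z^n, and there the difference is at most 3. *)
Lemma pgf_abel_bound (L eps z : R) M n :
  0 <= L <= 3 -> 0 <= eps ->
  (forall j, (M <= j)%N -> `|pgf_diag R j - L| <= eps) ->
  0 <= z < 1 ->
  `|(1 - z) * (n%:R * (F 0 n).[z]) - L| <= eps + 3 * M%:R * (1 - z) + 6 * z ^+ n.
Proof.
move=> /andP[L0 L3] eps0 aM /andP[z0 z1].
pose D := (maxn (size (F 0 n)) n.+1 + M)%N.
have nD : (n < D)%N by rewrite /D; lia.
have MD : (M <= D)%N by rewrite /D; lia.
have z1' : 0 < 1 - z by rewrite subr_gt0.
have zn j : 0 <= z ^+ j by rewrite exprn_ge0.
have zn1 j : z ^+ j <= 1 by rewrite exprn_ile1// ltW.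
have -> : (1 - z) * (n%:R * (F 0 n).[z]) - L =
    \sum_(0 <= j < D) ((1 - z) * z ^+ j) * (n%:R * (F 0 n)`_j - L) - L * z ^+ D.
  rewrite (@horner_coef_wide _ D); last by rewrite /D; lia.
  rewrite -(big_mkord xpredT (fun i => (F 0 n)`_i * z ^+ i)).
  under [in RHS]eq_bigr do rewrite mulrBr.
  rewrite sumrB -mulr_suml sum_geometric_telescope// expr0.
  rewrite !mulr_sumr [X in _ = X - _ - _](_ : _ = \sum_(0 <= i < D) (1 - z) * (n%:R * ((F 0 n)`_i * z ^+ i))).
    by ring.
  by apply: eq_bigr => j _; ring.
apply: le_trans (ler_normB _ _) _.
rewrite [X in _ + X]ger0_norm; last by rewrite mulr_ge0.
have c j : 0 <= (1 - z) * z ^+ j by rewrite mulr_ge0// ltW.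
have bnd j : `|n%:R * (F 0 n)`_j - L| <= eps + 3 * (j < M)%:R + 3 * (n < j)%:R.
  have q0 : 0 <= n%:R * (F 0 n)`_j by rewrite mulr_ge0// pgf_coef_ge0.
  have q3 := pgf0_coef_le3 R n j.
  have d3 : `|n%:R * (F 0 n)`_j - L| <= 3 by rewrite ler_norml; lra.
  have [nj|jn] := ltnP n j; first by case: (j < M)%N => /=; lra.
  have [jM|Mj] := ltnP j M; first by rewrite /=; lra.
  by rewrite /= !mulr0 !addr0 pgf0_coef_low// aM.
have zD : L * z ^+ D <= 3 * z ^+ n.
  by apply: ler_pM => //; apply: ler_wiXn2l => //; [exact: ltW|exact: ltnW].
apply: (@le_trans _ _ (\sum_(0 <= j < D) (1 - z) * z ^+ j * (eps + 3 * (j < M)%:R + 3 * (n < j)%:R) + 3 * z ^+ n)).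
  apply: lerD => //; apply: le_trans (ler_norm_sum _ _ _) _.
  by apply: ler_sum => j _; rewrite normrM ger0_norm// ler_wpM2l.
rewrite (_ : 6 * z ^+ n = 3 * z ^+ n + 3 * z ^+ n); last by ring.
rewrite addrA lerD2r.
under eq_bigr do rewrite !mulrDr.
rewrite !big_split/=; apply: lerD; first apply: lerD.
- rewrite -mulr_suml sum_geometric_telescope// expr0 ler_piMl// gerBl.
  exact: zn.
- rewrite (@big_cat_nat _ _ _ M)//= [X in _ + X]big_nat_cond [X in _ + X]big1 ?addr0.
    apply: (@le_trans _ _ (\sum_(0 <= j < M) 3 * (1 - z))).
      apply: ler_sum_nat => j /= ->; rewrite mulr1 [leRHS]mulrC ler_wpM2r//.
      by rewrite ler_piMr// ltW.
    by rewrite sumr_const_nat subn0 -[leLHS]mulr_natr mulrAC.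
  by move=> j /andP[/andP[Mj _] _]; rewrite ltnNge Mj/= !mulr0.
- rewrite (@big_cat_nat _ _ _ n.+1)//= [X in X + _]big_nat_cond [X in X + _]big1 ?add0r.
    rewrite (@eq_big_nat _ _ _ _ _ _ (fun j => 3 * ((1 - z) * z ^+ j))).
      rewrite -mulr_sumr sum_geometric_telescope// ler_wpM2l// lerBlDr.
      rewrite (@le_trans _ _ (z ^+ n)) ?lerDl//.
      by apply: ler_wiXn2l => //; exact: ltW.
    by move=> j /andP[-> _]; rewrite mulr1 mulrC.
  by move=> j /andP[/andP[_ jn] _]; rewrite ltnNge -ltnS jn/= !mulr0.
Qed.

Lemma expr_small z e : 0 <= z < 1 -> 0 < e ->
  exists N, forall n, (N <= n)%N -> z ^+ n <= e.
Proof.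
move=> /andP[z0 z1] e0.
have /cvgnP_dist/(_ _ e0)[N NP] : (fun n => z ^+ n) @ \oo --> 0.
  by apply: cvg_expr; rewrite ger0_norm.
by exists N => n /NP; rewrite subr0 ger0_norm// exprn_ge0.
Qed.

(** By [prodE] the Abel sum is (1 - z) exp([log_poly R n](z)), which tends to 1 as n grows, times
    [euler_prod n z]. It is compared with L on one side and with e^-gamma on the other. *)
Lemma cvg_pgf_diag_euler :
  pgf_diag R @ \oo --> expR (- euler_mascheroni R).
Proof.
have [L aL] := cvg_pgf_diag R; have := aL.
set w := expR (- _).
have L0 : 0 <= L.
  rewrite -(cvg_lim (@Rhausdorff R) aL); apply: limr_ge.
    by apply/cvg_ex; exists L.
  by apply: nearW => n; exact: pgf_diag_ge0.
have L3 : L <= 3.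
  rewrite -(cvg_lim (@Rhausdorff R) aL); apply: limr_le.
    by apply/cvg_ex; exists L.
  by apply: nearW => n; exact: pgf_diag_le3.
have L03 : 0 <= L <= 3 by rewrite L0.
have prodE n z : (1 - z) * (n%:R * (F 0 n).[z]) =
    (1 - z) * expR (log_poly R n).[z] * euler_prod n z.
  rewrite /euler_prod expRN; have := expR_gt0 (log_poly R n).[z].
  by move=> e0; field; rewrite gt_eqF.
suff -> : L = w by [].
have w0 : 0 < w by exact: expR_gt0.
apply/eqP; rewrite eq_le; apply/andP; split; apply/ler_addgt0Pr => e' e'0.
  (* Upper bound on L: M is given by e, z by M so that 3 M (1 - z) <= e, and n by z. The terms e and
     1 in the denominator keep z in [0, 1[. *)
  pose e := e' / 3; have e0 : 0 < e by rewrite divr_gt0.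
  have [M MP] := (cvgnP_dist _ _).1 aL e e0.
  have M0 : 0 <= M%:R :> R by [].
  have d0 : 0 < 3 * M%:R + e + 1 by lra.
  pose z := 1 - e / (3 * M%:R + e + 1).
  have z1E : 1 - z = e / (3 * M%:R + e + 1) by rewrite /z; ring.
  have z1 : 0 < 1 - z by rewrite z1E divr_gt0.
  have zz : 0 <= z < 1.
    rewrite -[z < 1]subr_gt0 z1 andbT subr_ge0 ler_pdivrMr//; lra.
  have [n nP] := expr_small zz (divr_gt0 e0 (ltr0Sn R 5)).
  have := pgf_abel_bound n L03 (ltW e0) MP zz.
  have := nP n (leqnn n); rewrite ler_pdivlMr// mulrC => zn.
  have Mz : 3 * M%:R * (1 - z) <= e.
    rewrite z1E mulrA ler_pdivrMr// mulrC ler_pM2l//; lra.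
  have [z0 /ltW z1'] := andP zz.
  have /andP[_ E1] := log_poly_exp_le n zz.
  have V : (1 - z) * (n%:R * (F 0 n).[z]) <= w.
    rewrite prodE; apply: le_trans (euler_prod1_le R n).
    apply: le_trans (euler_prod_le_at1 n z0).
    by rewrite ler_piMl// /euler_prod !mulr_ge0 ?expR_ge0// pgf_horner_ge0.
  move=> /ler_normlP[h _]; rewrite /e in Mz zn h *; lra.
(* Lower bound on L: K is fixed first, with [euler_prod K 1] close to the limit; then z close to 1
   by continuity at fixed K; then n >= K large, monotonicity leading from K to n. *)
pose e := e' / 6; have e0 : 0 < e by rewrite divr_gt0.
have [M MP] := (cvgnP_dist _ _).1 aL e e0.
have [K /(_ K (leqnn K)) KP] := (cvgnP_dist _ _).1 (@cvg_euler_prod1 R) e e0.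
have M0 : 0 <= M%:R :> R by [].
have d0 : 0 < 3 * M%:R + e + 1 by lra.
have [z [zK zz Mz]] : exists z, [/\ `|euler_prod K 1 - euler_prod K z| <= e,
    0 <= z < 1 & 3 * M%:R * (1 - z) <= e].
  near (1 : R)^'- => z; exists z; split.
  - near: z; have /cvgrPdist_le := @euler_prod_cvg1 R K; exact.
  - by apply/andP; split; near: z; [exact: nbhs_left_ge|exact: nbhs_left_lt].
  - have z1d : 1 - z < e / (3 * M%:R + e + 1).
      by near: z; apply: nbhs_left_ltBl; rewrite divr_gt0.
    rewrite ltr_pdivlMr// in z1d.
    have : z < 1 by near: z; exact: nbhs_left_lt.
    by nra.
have [z0 z1] := andP zz.
have z1' : 0 < 1 - z by rewrite subr_gt0.
have [n1 n1P] := expr_small zz (divr_gt0 e0 (ltr0Sn R 5)).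
have [n2 n2P] := expr_small zz (mulr_gt0 e0 z1').
pose n := (n1 + n2 + K)%N.
have Kn : (K <= n)%N by exact: leq_addl.
have := pgf_abel_bound n L03 (ltW e0) MP zz.
have n1n : (n1 <= n)%N by rewrite /n -addnA leq_addr.
have n2n : (n2 <= n)%N by rewrite /n addnAC leq_addl.
have := n1P n n1n; rewrite ler_pdivlMr// mulrC => zn1.
have := n2P n n2n; rewrite -ler_pdivrMr// => zn2.
have /andP[E0 _] := log_poly_exp_le n zz.
have Vn : euler_prod K z <= euler_prod n z.
  by apply: euler_prod_nondecreasing => //; rewrite z0 ltW.
have VK0 : 0 <= euler_prod K z.
  by rewrite /euler_prod !mulr_ge0 ?expR_ge0// pgf_horner_ge0.
have VK1 : euler_prod K z <= 1.
  exact: le_trans (euler_prod_le_at1 K z0) (euler_prod1_le1 R K).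
have V : (1 - e) * euler_prod K z <= (1 - z) * (n%:R * (F 0 n).[z]).
  rewrite prodE; apply: (@le_trans _ _ ((1 - z) * expR (log_poly R n).[z] * euler_prod K z)).
    by rewrite ler_wpM2r//; lra.
  by rewrite ler_wpM2l// mulr_ge0 ?expR_ge0// ltW.
move=> /ler_normlP[_ h]; move/ler_normlP: zK => [_ zK].
move/ler_normlP: KP => [KP _].
have : e * euler_prod K z <= e by rewrite ler_piMr// ltW.
move: KP zK V; rewrite -/w mulrBl mul1r => KP zK V.
rewrite /e in Mz zn1 zn2 h e0 KP zK V *; lra.
Unshelve. all: by end_near. Qed.

End abel.

(** * The Dickman function and the local limit theorem *)

Section dickman.
Variables (R : realType) (rho : R -> R).
Hypothesis rhoP : is_dickman rho.
Implicit Types (m n i j k : nat) (x y : R).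

Local Notation F := (pgf R).

Lemma dickman01 x : 0 <= x <= 1 -> rho x = 1.
Proof. by case: rhoP => _ + _; apply. Qed.

Lemma dickman_bounded (K : R) :
  exists2 B, 0 <= B & forall x, 0 <= x <= K -> `|rho x| <= B.
Proof.
have [K0|K0] := leP 0 K; last first.
  by exists 0 => // x /andP[x0 xK]; have := le_lt_trans (le_trans x0 xK) K0; rewrite ltxx.
have cr : {within `[0, K], continuous rho}.
  case: rhoP => + _ _; apply: continuous_subspaceW => x /=.
  by rewrite !in_itv/= andbT => /andP[].
have [c _ cP] := EVT_max K0 cr.
have [b _ bP] := EVT_min K0 cr.
exists (`|rho c| + `|rho b|) => [|x xK]; first by rewrite addr_ge0.
have xI : x \in `[0, K] by rewrite in_itv.
have := cP _ xI; have := bP _ xI.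
have := ler_norm (rho c); have := ler_norm (- rho b); rewrite normrN.
have := normr_ge0 (rho c); have := normr_ge0 (rho b).
by move=> *; rewrite ler_norml; lra.
Qed.

Lemma dickman_mvt x y : 1 <= x -> x < y ->
  exists2 c, x < c < y & rho y - rho x = - (rho (c - 1) / c) * (y - x).
Proof.
move=> x1 xy.
have dr z : z \in `]x, y[ -> is_derive z 1 rho (- (rho (z - 1) / z)).
  rewrite in_itv/= => /andP[xz zy].
  have z1 : 1 < z by exact: le_lt_trans xz.
  case: rhoP => _ _ /(_ z z1)[dz ez]; apply: DeriveDef => //.
  rewrite -derive1E; apply: (mulfI (_ : z != 0)); first by rewrite gt_eqF//; lra.
  rewrite mulrN mulrCA mulfV ?mulr1 ?gt_eqF//; lra.
have cr : {within `[x, y], continuous rho}.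
  case: rhoP => + _ _; apply: continuous_subspaceW => z /=.
  by rewrite !in_itv/= andbT => /andP[xz _]; lra.
have [c] := MVT xy dr cr; rewrite in_itv/= => cxy ->.
by exists c.
Qed.

(** Beyond 1 the slope -rho(c - 1)/c is bounded by the maximum of |rho|; on [0, 1] the function is
    constant, so a left endpoint below 1 may be moved to 1. *)
Lemma dickman_lipschitz (K : R) : exists2 C, 0 <= C &
  forall x y, 0 <= x <= K -> 0 <= y <= K -> `|rho x - rho y| <= C * `|x - y|.
Proof.
have [B B0 BP] := dickman_bounded K; exists B => // x y.
wlog xy : x y / x <= y.
  move=> h; have [|/ltW] := leP x y; first exact: h.
  by rewrite distrC (distrC x) => yx xK yK; exact: h.
move=> /andP[x0 xK] /andP[y0 yK].
have main u : 1 <= u -> u < y -> `|rho u - rho y| <= B * (y - u).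
  move=> u1 uy; have [c /andP[uc cy]] := dickman_mvt u1 uy.
  have yu : 0 <= y - u by lra.
  rewrite distrC => ->; rewrite normrM normrN (ger0_norm yu) ler_wpM2r//.
  rewrite normrM -[leRHS]mulr1.
  have c1 : 1 < c by exact: le_lt_trans uc.
  apply: ler_pM => //; first by apply: BP; lra.
  by rewrite ger0_norm ?invr_ge0 ?invf_le1; lra.
rewrite (distrC x) (@ger0_norm _ (y - x)) ?subr_ge0//.
have [y1|y1] := leP y 1.
  by rewrite !dickman01 ?subrr ?normr0 ?mulr_ge0 ?subr_ge0//; lra.
have [x1|x1] := leP x 1.
  rewrite (_ : rho x = rho 1); last by rewrite !dickman01//; lra.
  by apply: le_trans (main 1 _ _) _ => //; rewrite ler_wpM2l//; lra.
have [<-|xney] := eqVneq x y; first by rewrite subrr normr0 subrr mulr0.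
by apply: main; [exact: ltW|rewrite lt_neqAle xney].
Qed.

(* Discretisation of x rho'(x) + rho(x - 1) = 0 along x = m / n. *)
Lemma dickman_step K : exists2 C, 0 <= C &
  forall n m, (0 < n)%N -> (n < m)%N -> (m <= K * n)%N ->
  `|rho (m%:R / n.+1%:R) - rho (m%:R / n%:R) - rho ((m - n.+1)%:R / n%:R) / n%:R|
    <= C / n%:R ^+ 2.
Proof.
have [B B0 BP] := dickman_bounded K%:R.
have [C C0 CP] := dickman_lipschitz K%:R.
exists (B + C * (K%:R + 1)); first by rewrite addr_ge0// mulr_ge0.
move=> n m n0 nm mK.
have x0 : 1 <= n%:R :> R by rewrite ler1n.
have xK : m%:R <= K%:R * n%:R :> R by rewrite -natrM ler_nat.
have xm : n%:R + 1 <= m%:R :> R by rewrite natr1 ler_nat.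
rewrite natrB// -natr1.
move: (n%:R) (m%:R) x0 xK xm => x y x1 xK xm.
have x0 : 0 < x by lra.
have lt1 : y / (x + 1) < y / x.
  by rewrite ltr_pM2l ?ltf_pV2 ?posrE; lra.
have ge1 : 1 <= y / (x + 1) by rewrite ler_pdivlMr; lra.
have [c /andP[lc cu]] := dickman_mvt ge1 lt1.
have c0 : 0 < c by lra.
move/(congr1 -%R); rewrite opprB => ->.
set u := (y - (x + 1)) / x.
have yK : y / x <= K%:R by rewrite ler_pdivrMr.
have uE : u = y / x - 1 - x^-1 by rewrite /u; field; lra.
have u0 : 0 <= u by rewrite /u divr_ge0; lra.
have xi0 : 0 < x^-1 by rewrite invr_gt0.
have gap : y / x - y / (x + 1) <= K%:R / x.
  rewrite (_ : y / x - y / (x + 1) = y / (x + 1) / x); last by field; lra.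
  by rewrite ler_pM2r//; lra.
(* The increment of rho equals rho(c - 1) th / x. As c lies between y/(x + 1) and y/x, th lies in
   [1 - 1/x, 1], and c - 1 is within (K + 1)/x of u. *)
set th := y / (c * (x + 1)).
have -> : - (- (rho (c - 1) / c) * (y / x - y / (x + 1))) - rho u / x =
   (rho (c - 1) * (th - 1) + (rho (c - 1) - rho u)) / x.
  by rewrite /th; field; lra.
rewrite normrM (@gtr0_norm _ x^-1)// expr2 invfM mulrA ler_pM2r//.
apply: le_trans (ler_normD _ _) _; rewrite mulrDl; apply: lerD.
  rewrite normrM; apply: ler_pM => //; first by apply: BP; lra.
  have th1 : th <= 1.
    rewrite /th ler_pdivrMr ?mulr_gt0//; last by lra.
    by move: lc; rewrite ltr_pdivrMr; lra.
  have th2 : 1 - x^-1 <= th.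
    rewrite /th ler_pdivlMr ?mulr_gt0//; last by lra.
    move: cu; rewrite ltr_pdivlMr// => cu.
    rewrite [leLHS](_ : _ = c * x - c * x^-1); last by field; lra.
    by have := mulr_gt0 c0 xi0; lra.
  by rewrite ler_norml; lra.
apply: le_trans (CP _ _ _ _) _; [lra|lra|].
rewrite -mulrA ler_wpM2l// mulrDl mul1r ler_norml; lra.
Qed.

End dickman.

(** * Local limit theorem *)

Section local_limit.
Variables (R : realType) (rho : R -> R).
Hypothesis rhoP : is_dickman rho.
Implicit Types (m n i j k : nat).

Local Notation F := (pgf R).
Local Notation w := (expR (- euler_mascheroni R)).

Lemma sum_lt_le n M : \sum_(0 <= k < n) (k < M)%:R <= M%:R :> R.
Proof.
rewrite -natr_sum ler_nat.
suff -> : (\sum_(0 <= k < n) (k < M) = minn n M)%N by exact: geq_minr.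
elim: n => [|n IH]; first by rewrite big_geq// min0n.
by rewrite big_nat_recr//= IH; case: (ltnP n M) => /=; lia.
Qed.

Lemma sum_rev_lt_le m n M : \sum_(n <= k < m) (m - k.+1 < M)%:R <= M%:R :> R.
Proof.
rewrite big_nat_rev/=.
apply: (@le_trans _ _ (\sum_(n <= k < m) (k - n < M)%:R)).
  apply: ler_sum_nat => k /andP[nk km].
  by rewrite (_ : (m - (n + m - k.+1).+1 = k - n)%N)//; lia.
rewrite -{1}[n]add0n big_addn.
by under eq_bigr do rewrite addnK; exact: sum_lt_le.
Qed.

Definition dickman_error n m : R := n%:R * (F 0 n)`_m - w * rho (m%:R / n%:R).

(** The exact recurrence [pgfS_coef] minus w times its discretised analogue [dickman_step] is a
    recurrence for the error. *)
Lemma dickman_error_step K : exists2 C, 0 <= C &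
  forall n m, (0 < n)%N -> (n < m)%N -> (m <= K * n)%N ->
  `|dickman_error n m| <= `|dickman_error n.+1 m| +
     (`|dickman_error n (m - n.+1)| + C / n%:R) / n%:R.
Proof.
have [C C0 CP] := dickman_step rhoP K.
have w0 : 0 <= w by exact: expR_ge0.
exists (w * C); first by rewrite mulr_ge0.
move=> n m n0 nm mK.
have x0 : 0 < n%:R :> R by rewrite ltr0n.
have := CP n m n0 nm mK.
set D := rho _ - rho _ - _ => DC.
have E : dickman_error n m = dickman_error n.+1 m - dickman_error n (m - n.+1) / n%:R + w * D.
  rewrite /dickman_error /D (pgfS_coef R m (leq0n n)) coefMXn ltnNge nm/=.
  by field; lra.
rewrite E; apply: le_trans (ler_normD _ _) _; rewrite [X in _ <= _ + X]mulrDl addrA; apply: lerD.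
  by apply: le_trans (ler_normB _ _) _; rewrite normrM (@gtr0_norm _ n%:R^-1) ?invr_gt0.
by rewrite normrM ger0_norm// -!mulrA ler_wpM2l// -invfM -expr2.
Qed.

(** Iterating the step raises n up to m, where the error is that of the diagonal sequence. *)
Lemma dickman_error_sum K : exists2 C, 0 <= C &
  forall n m, (0 < n)%N -> (n <= m)%N -> (m <= K * n)%N ->
  `|dickman_error n m| <= `|dickman_error m m| +
     \sum_(n <= k < m) (`|dickman_error k (m - k.+1)| + C / n%:R) / n%:R.
Proof.
have [C C0 CP] := dickman_error_step K; exists C => // n m n0 nm mK.
have x0 : 0 < n%:R :> R by rewrite ltr0n.
apply: (@le_trans _ _ (`|dickman_error m m| +
     \sum_(n <= k < m) (`|dickman_error k (m - k.+1)| + C / k%:R) / k%:R)).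
  elim: {n}(m - n)%N {-2}n (erefl (m - n)%N) n0 nm mK x0 => [|d IH] n dE n0 nm mK x0.
    by rewrite big_geq ?addr0; [rewrite (_ : n = m)//; lia|lia].
  have nm' : (n < m)%N by lia.
  rewrite big_ltn// addrCA addrC; apply: le_trans (CP n m n0 nm' mK) _.
  rewrite lerD2r; apply: IH => //; first by lia.
  by rewrite (leq_trans mK)// leq_mul2l leqnSn orbT.
rewrite lerD2l; apply: ler_sum_nat => k /andP[nk km].
have kn : k%:R^-1 <= n%:R^-1 :> R.
  by rewrite lef_pV2 ?posrE ?ltr0n ?ler_nat//; lia.
apply: ler_pM => //; first by rewrite addr_ge0// mulr_ge0.
by rewrite lerD2l ler_wpM2l.
Qed.

(** Induction on K: if m <= (K + 1) n and n <= k, then m - k - 1 <= K k, so the induction hypothesis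
    bounds the summands of [dickman_error_sum]. It misses at most M1 of them, those with m - k - 1 <
    M1, for which the error is at most 3 + w B. *)
Lemma pgf_dickman K (eta : R) : 0 < eta -> exists M, forall n m,
  (M <= m)%N -> (0 < n)%N -> (m <= K * n)%N -> `|dickman_error n m| <= eta.
Proof.
elim: K eta => [|K IH] eta eta0.
  by exists 1%N => n m m0 _; rewrite mul0n leqn0 gtn_eqF.
have w0 : 0 <= w by exact: expR_ge0.
(* The final bound consists of e from the diagonal, K e from the sum and e from A / n. *)
pose e := eta / K.+3%:R.
have e0 : 0 < e by rewrite divr_gt0.
have [M1 M1P] := IH e e0.
have [M2 M2P] := (cvgnP_dist _ _).1 (@cvg_pgf_diag_euler R) e e0.
have [C C0 CP] := dickman_error_sum K.+1.
have [B B0 BP] := dickman_bounded rhoP K%:R.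
pose A := (3 + w * B) * M1%:R + K%:R * C.
have A0 : 0 <= A by rewrite addr_ge0// mulr_ge0// addr_ge0// mulr_ge0.
have [N NP] : exists N, A / e <= N%:R.
  by exists (Num.truncn (A / e)).+1; rewrite ltW// truncnS_gt.
(* Since m <= (K + 1) n, requiring m >= (K + 1) N forces n >= N, hence A / n <= e. *)
exists (maxn M2 (K.+1 * N)) => n m; rewrite geq_max => /andP[m2 mN] n0 mK.
have e_eta : e <= eta by rewrite ler_pdivrMr// ler_peMr ?ler1n// ltW.
have [mn|nm] := leqP m n.
  apply: le_trans e_eta; rewrite /dickman_error pgf0_coef_low// (dickman01 rhoP) ?mulr1.
    exact: M2P.
  by rewrite divr_ge0//= ler_pdivrMr ?ltr0n// mul1r ler_nat.
have x0 : 0 < n%:R :> R by rewrite ltr0n.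
have Nn : (N <= n)%N by rewrite -(@leq_pmul2l K.+1)// (leq_trans mN).
have := CP n m n0 (ltnW nm) mK.
have dm : `|dickman_error m m| <= e.
  rewrite /dickman_error divff ?gt_eqF ?ltr0n//; last by lia.
  by rewrite (dickman01 rhoP) ?mulr1 ?ler01 ?lexx// M2P.
have dk k : (n <= k < m)%N ->
    `|dickman_error k (m - k.+1)| <= e + (3 + w * B) * (m - k.+1 < M1)%:R.
  move=> /andP[nk km].
  have k0 : (0 < k)%N by lia.
  have mk : (m - k.+1 <= K * k)%N.
    rewrite leq_subLR; apply: leq_trans mK _; rewrite mulSn leq_add//.
      exact: leqW.
    by rewrite leq_mul2l nk orbT.
  have [lt|ge] := ltnP; last by rewrite mulr0 addr0; exact: M1P.
  rewrite mulr1 /dickman_error; apply: le_trans (ler_normB _ _) _.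
  rewrite ger0_norm; last by rewrite mulr_ge0// pgf_coef_ge0.
  apply: (@le_trans _ _ (3 + w * B)); last by rewrite lerDr ltW.
  apply: lerD; first exact: pgf0_coef_le3.
  rewrite normrM ger0_norm// ler_wpM2l// BP// divr_ge0//=.
  by rewrite ler_pdivrMr ?ltr0n// -natrM ler_nat.
move=> /le_trans; apply.
have mnK : (m - n)%:R <= K%:R * n%:R :> R.
  by rewrite -natrM ler_nat leq_subLR -mulSn.
apply: (@le_trans _ _ (e + (K%:R * n%:R * (e + C / n%:R) + (3 + w * B) * M1%:R) / n%:R)).
  apply: lerD => //; rewrite -mulr_suml ler_pM2r ?invr_gt0//.
  apply: (@le_trans _ _ (\sum_(n <= k < m) ((e + C / n%:R) + (3 + w * B) * (m - k.+1 < M1)%:R))).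
    by apply: ler_sum_nat => k /dk; lra.
  rewrite big_split/= sumr_const_nat -mulr_sumr; apply: lerD.
    have eC : 0 <= e + C / n%:R by rewrite addr_ge0 ?divr_ge0// ltW.
    by rewrite -[leLHS]mulr_natl ler_wpM2r.
  by rewrite ler_wpM2l ?sum_rev_lt_le// addr_ge0// mulr_ge0.
have An : A / n%:R <= e.
  rewrite ler_pdivrMr// mulrC -ler_pdivrMr//; apply: le_trans NP _.
  by rewrite ler_nat.
rewrite (_ : _ / n%:R = K%:R * e + A / n%:R); last by rewrite /A; field; lra.
have -> : eta = e * K.+3%:R by rewrite /e divfK// pnatr_eq0.
by rewrite -addn3 natrD; lra.
Qed.

End local_limit.

(** * Decorrelation *)

Section decorrelation.
Variable R : realType.
Implicit Types (m n i j k : nat).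

Local Notation F := (pgf R).

(** The probability that j - n <= T_n - T_m < j - m. *)
Let window m n j : R := \sum_(m.+1 <= k < n.+1) (F m n * 'X^k)`_j.

(** Every k in the sum exceeds m, so replacing [pgf_omit] by [pgf] costs at most 2/m times
    coefficients whose two sums are each at most 1. *)
Lemma pgf_coefM_window m n j : (0 < m)%N -> (m <= n)%N ->
  `|j%:R * (F m n)`_j - window m n j| <= 4 / m%:R.
Proof.
move=> m0 mn; rewrite pgf_coefM// /window -sumrB.
have mi : 0 < m%:R :> R by rewrite ltr0n.
apply: le_trans (ler_norm_sum _ _ _) _.
apply: (@le_trans _ _ (\sum_(m.+1 <= k < n.+1)
    (2 / m%:R * (F m n * 'X^(1 * k))`_j + 2 / m%:R * (F m n * 'X^(2 * k))`_j))).
  apply: ler_sum_nat => k /andP[mk kn].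
  have k1 : (1 < k)%N by exact: leq_ltn_trans mk.
  have mkn : (m < k <= n)%N by rewrite mk.
  apply: le_trans (pgf_omit_approx R j k1 mkn) _; rewrite -mulrDr ler_wpM2r//.
    by rewrite addr_ge0// nneg_coefMXn_ge0//; exact: pgf_nneg.
  by rewrite ler_wpM2l// lef_pV2 ?posrE ?ltr0n ?ler_nat// ltnW// ltnW.
rewrite big_split/= -!mulr_sumr -mulrDr (_ : 4 / m%:R = 2 / m%:R * 2); last by ring.
rewrite ler_wpM2l ?divr_ge0//.
have h c := @sum_coefMXn_le R (F m n) j c m.+1 n.+1 (@pgf_nneg R m n).
by have := h 1%N isT; have := h 2%N isT; rewrite pgf_horner1; lra.
Qed.

(** Each coefficient is at most 3/n, except the constant one, reached at k = j and equal to m/n. *)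
Lemma pgf_window_part m n j p h : (m <= n)%N ->
  n%:R * \sum_(p <= k < p + h) (F m n * 'X^k)`_j <= 3 * h%:R + m%:R.
Proof.
move=> mn; rewrite mulr_sumr.
apply: (@le_trans _ _ (\sum_(p <= k < p + h) (3 + if k == j then m%:R else 0))).
  apply: ler_sum => k _; rewrite coefMXn; case: ltngtP => [jk|kj|->].
  - by rewrite mulr0 addr0.
  - by rewrite addr0 mulr_pgf_coef_le3// subn_gt0.
  - by rewrite subnn pgf_coef0// lerDr.
rewrite big_split/= -big_mkcond/= big_nat1_eq sumr_const_nat addKn.
by rewrite -[_ *+ h]mulr_natr lerD2l; case: ifP.
Qed.

(** Two windows shifted by h differ only in h indices at each end, and only one end counts for an
    upper bound. *)
Lemma pgf_windowB m n j j' h : (m <= n)%N -> (j = j' + h \/ j' = j + h)%N ->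
  n%:R * (window m n j - window m n j') <= 3 * h%:R + m%:R.
Proof.
move=> mn jj'; rewrite /window.
have G0 k i : 0 <= (F m n * 'X^k)`_i by apply/nneg_coefMXn_ge0/pgf_nneg.
have shift i k : (F m n * 'X^k)`_i = (F m n * 'X^(k + h))`_(i + h).
  by rewrite !coefMXn ltn_add2r subnDr.
have shift_sum i : \sum_(m.+1 <= k < n.+1) (F m n * 'X^k)`_i =
    \sum_(m.+1 + h <= k < n.+1 + h) (F m n * 'X^k)`_(i + h).
  by rewrite big_addn addnK; apply: eq_bigr => k _; exact: shift.
have mh : (m.+1 <= m.+1 + h)%N by rewrite leq_addr.
have nh : (n.+1 <= n.+1 + h)%N by rewrite leq_addr.
have mnh : (m.+1 + h <= n.+1 + h)%N by rewrite leq_add2r.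
case: jj' => ->.
  apply: le_trans (pgf_window_part (j' + h) m.+1 h mn); rewrite ler_wpM2l//.
  rewrite (shift_sum j') lerBlDr -big_cat_nat//.
  by rewrite [leRHS](@big_cat_nat _ _ _ n.+1)//= lerDl sumr_ge0.
apply: le_trans (pgf_window_part (j + h) n.+1 h mn); rewrite ler_wpM2l//.
rewrite (shift_sum j) lerBlDr addrC -big_cat_nat//.
by rewrite [leRHS](@big_cat_nat _ _ _ (m.+1 + h))//= lerDr sumr_ge0.
Qed.

Lemma pgf_coefB m n j j' h : (0 < m)%N -> (m <= n)%N ->
  (j = j' + h \/ j' = j + h)%N ->
  j%:R * (F m n)`_j - j'%:R * (F m n)`_j' <= (3 * h%:R + m%:R) / n%:R + 8 / m%:R.
Proof.
move=> m0 mn jj'; have n0 : 0 < n%:R :> R by rewrite ltr0n (leq_trans m0).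
have := pgf_windowB mn jj'; rewrite mulrC -ler_pdivlMr//.
have /ler_normlP[_] := pgf_coefM_window j m0 mn.
have /ler_normlP[+ _] := pgf_coefM_window j' m0 mn.
have -> : 8 / m%:R = 4 / m%:R + 4 / m%:R :> R by ring.
by lra.
Qed.

Lemma sum_coef_mul_nat (p : {poly R}) D : (size p <= D)%N ->
  \sum_(i < D) i%:R * p`_i = p^`().[1] :> R.
Proof.
move=> pD; have -> : p^`().[1] = (p^`() * 'X).[1] by rewrite hornerMX mulr1.
rewrite (@horner1_wide _ _ D).
  apply: eq_bigr => i _; rewrite coefMX coef_deriv.
  by case: (i : nat) => [|k]/=; rewrite ?mul0r// mulr_natl.
apply: leq_trans pD; have [->|p0] := eqVneq p 0.
  by rewrite -polyC0 derivC mul0r !size_poly0.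
apply: leq_trans (size_polyMleq _ _) _; rewrite size_polyX addn2/=.
exact: lt_size_deriv.
Qed.

(** P(T_n = b) is the average of P(T_n - T_m = b - i) over the law of T_m. By slow variation, b - i
    may be exchanged for b - a at a cost affine in i, whose average needs only the mean m of T_m. *)
Lemma pgf_decorrelation (A c : R) m n a b : 0 <= A -> 0 < c ->
  (0 < m)%N -> (m <= n)%N -> (a < b)%N -> a%:R <= A * m%:R -> c * n%:R <= b%:R ->
  (F m n)`_(b - a) - (F 0 n)`_b <= (6 * A + 12) / c * (m%:R / n%:R ^+ 2 + (m%:R * n%:R)^-1).
Proof.
move=> A0 c0 m0 mn ab aA bc.
have n0 : (0 < n)%N by exact: leq_trans mn.
have x0 : 0 < m%:R :> R by rewrite ltr0n.
have y0 : 0 < n%:R :> R by rewrite ltr0n.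
have b0 : 0 < b%:R :> R by rewrite (lt_le_trans _ bc)// mulr_gt0.
(* In the coefficient of m, 3 A + 1 comes from [pgf_coefB] with shift at most i + a, and 3 A from
   trading the weight b - a for b. *)
pose E i : R := (3 * i%:R + (6 * A + 1) * m%:R) / n%:R + 8 / m%:R.
have E0 i : 0 <= E i.
  by rewrite addr_ge0 ?divr_ge0// addr_ge0// mulr_ge0// addr_ge0// mulr_ge0.
have Gj : n%:R * (F m n)`_(b - a) <= 3 by rewrite mulr_pgf_coef_le3// subn_gt0.
have key i : (F m n)`_(b - a) <= (if (i <= b)%N then (F m n)`_(b - i) else 0) + E i / (c * n%:R).
  have cn0 : 0 < c * n%:R by rewrite mulr_gt0.
  (* For i > b the term E i alone suffices: it is at least 3 b / n >= 3 c. *)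
  case: ifP => ib; last first.
    rewrite add0r ler_pdivlMr// mulrC -mulrA; apply: (@le_trans _ _ (3 * c)).
      by rewrite mulrC (ler_wpM2r (ltW c0)).
    rewrite /E -[leLHS]addr0; apply: lerD; last by rewrite divr_ge0.
    rewrite ler_pdivlMr// -[leLHS]addr0 -mulrA; apply: lerD.
      rewrite ler_wpM2l//; apply: le_trans bc _; rewrite ler_nat.
      by move: ib; rewrite leqNgt => /negbFE/ltnW.
    by rewrite mulr_ge0// addr_ge0// mulr_ge0.
  set j := (b - a)%N; set j' := (b - i)%N.
  have [h hE hle] : exists2 h, (j = j' + h \/ j' = j + h)%N & (h <= i + a)%N.
    have [ia|ai] := leqP i a.
      by exists (a - i)%N; [right; rewrite /j /j'; lia|lia].
    by exists (i - a)%N; [left; rewrite /j /j'; lia|lia].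
  have B := pgf_coefB m0 mn hE.
  have hle' : h%:R <= i%:R + a%:R :> R by rewrite -natrD ler_nat.
  have Gj'0 : 0 <= (F m n)`_j' by exact: pgf_coef_ge0.
  have jE : j%:R = b%:R - a%:R :> R by rewrite natrB// ltnW.
  have j'E : j'%:R = b%:R - i%:R :> R by rewrite natrB.
  have Gj' : (F m n)`_j <= 3 / n%:R by rewrite ler_pdivlMr// mulrC.
  have aG : a%:R * (F m n)`_j <= A * m%:R * (3 / n%:R).
    by apply: ler_pM => //; exact: pgf_coef_ge0.
  have iG : 0 <= i%:R * (F m n)`_j' by rewrite mulr_ge0.
  have bG : b%:R * ((F m n)`_j - (F m n)`_j') <= E i.
    rewrite jE j'E in B.
    have : (3 * h%:R + m%:R) / n%:R <= (3 * (i%:R + A * m%:R) + m%:R) / n%:R.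
      rewrite ler_pM2r ?invr_gt0//; lra.
    have -> : E i = (3 * (i%:R + A * m%:R) + m%:R) / n%:R + 8 / m%:R + A * m%:R * (3 / n%:R).
      by rewrite /E; field; lra.
    by lra.
  rewrite -lerBlDl ler_pdivlMr// mulrC.
  have [d0|d0] := leP 0 ((F m n)`_j - (F m n)`_j').
    by apply: le_trans bG; rewrite ler_wpM2r.
  by apply: le_trans (E0 i); rewrite pmulr_rle0// ltW.
pose D := maxn (size (F 0 m)) b.+1.
have sD : (size (F 0 m) <= D)%N by rewrite leq_maxl.
have bD : (b.+1 <= D)%N by rewrite leq_maxr.
have F0 i : 0 <= (F 0 m)`_i by exact: pgf_coef_ge0.
have s1 : \sum_(i < D) (F 0 m)`_i = 1 by rewrite -horner1_wide// pgf_horner1.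
have sm : \sum_(i < D) i%:R * (F 0 m)`_i = m%:R.
  by rewrite sum_coef_mul_nat// pgf_mean// subr0.
have conv : \sum_(i < D) (F 0 m)`_i * (if (i <= b)%N then (F m n)`_(b - i) else 0) = (F 0 n)`_b.
  rewrite (pgf_cat R (leq0n m) mn) coefM (big_ord_widen D (fun i => (F 0 m)`_i * (F m n)`_(b - i)) bD).
  by rewrite [RHS]big_mkcond/=; apply: eq_bigr => i _; rewrite ltnS; case: ifP; rewrite ?mulr0.
have : \sum_(i < D) (F 0 m)`_i * (F m n)`_(b - a) <=
    \sum_(i < D) (F 0 m)`_i * ((if (i <= b)%N then (F m n)`_(b - i) else 0) + E i / (c * n%:R)).
  by apply: ler_sum => i _; rewrite ler_wpM2l.
rewrite -mulr_suml s1 mul1r.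
under eq_bigr do rewrite mulrDr.
rewrite big_split/= conv -lerBlDl => /le_trans; apply.
have -> : \sum_(i < D) (F 0 m)`_i * (E i / (c * n%:R)) =
    ((3 * m%:R + (6 * A + 1) * m%:R) / n%:R + 8 / m%:R) / (c * n%:R).
  rewrite (eq_bigr (fun i : 'I_D => 3 / n%:R / (c * n%:R) * (i%:R * (F 0 m)`_i) +
      ((6 * A + 1) * m%:R / n%:R + 8 / m%:R) / (c * n%:R) * (F 0 m)`_i)).
    by rewrite big_split/= -!mulr_sumr sm s1; ring.
  by move=> i _; rewrite /E; ring.
rewrite -subr_ge0.
rewrite [leRHS](_ : _ = (8 * (m%:R / n%:R ^+ 2) + (6 * A + 4) * (m%:R * n%:R)^-1) / c).
  by apply: divr_ge0; [rewrite addr_ge0// mulr_ge0// ?divr_ge0 ?invr_ge0 ?mulr_ge0 ?exprn_ge0//; lra|exact: ltW].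
by field; lra.
Qed.

(** The decorrelation bound is multiplied by P(T_m = a) <= 3/m. *)
Lemma pgf_cov_bound (A c : R) m n a b : 0 <= A -> 0 < c ->
  (0 < m)%N -> (m <= n)%N -> (a < b)%N -> a%:R <= A * m%:R -> c * n%:R <= b%:R ->
  (F 0 m)`_a * (F m n)`_(b - a) - (F 0 m)`_a * (F 0 n)`_b <=
  3 * (6 * A + 12) / c * ((n%:R ^+ 2)^-1 + (m%:R ^+ 2 * n%:R)^-1).
Proof.
move=> A0 c0 m0 mn ab aA bc.
have x0 : 0 < m%:R :> R by rewrite ltr0n.
have y0 : 0 < n%:R :> R by rewrite ltr0n (leq_trans m0).
have := pgf_decorrelation A0 c0 m0 mn ab aA bc; set d := _ - _ => dle.
have f3 : (F 0 m)`_a <= 3 / m%:R by rewrite ler_pdivlMr// mulrC pgf0_coef_le3.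
rewrite -mulrBr -/d; apply: le_trans (ler_wpM2l (pgf_coef_ge0 _ _ _ _) dle) _.
apply: le_trans (ler_wpM2r _ f3) _.
  apply: mulr_ge0; first by apply: divr_ge0; [lra|exact: ltW].
  by rewrite addr_ge0// ?divr_ge0 ?invr_ge0 ?mulr_ge0 ?exprn_ge0.
by rewrite le_eqVlt; apply/orP; left; apply/eqP; field; lra.
Qed.

End decorrelation.

(** * Joint law of T_m and T_n - T_m *)

Section joint_law.
Context d (Omega : measurableType d) (R : realType) (P : probability Omega R)
  (Z : nat -> {RV P >-> R}).
Hypothesis Zindep : independent_RVs [set k : nat | (1 <= k)%N] Z.
Hypothesis Z1 : forall k : nat, (1 <= k)%N -> P [set w | Z k w = 1] = (k%:R^-1)%:E.
Hypothesis Z0 : forall k : nat, (1 <= k)%N -> P [set w | Z k w = 0] = (1 - k%:R^-1)%:E.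

Local Notation F := (pgf R).

Definition weighted_block m n (w : Omega) : R := \sum_(m.+1 <= k < n.+1) k%:R * Z k w.

Definition cylinder l (b : nat -> bool) : set Omega :=
  [set w | forall k, (0 < k <= l)%N -> Z k w = (b k)%:R].

Definition cylinder_mass l (b : nat -> bool) : R :=
  \prod_(1 <= k < l.+1) (if b k then k%:R^-1 else 1 - k%:R^-1).

Lemma measurable_fiber k (r : R) : measurable [set w | Z k w = r].
Proof. exact: (measurable_funPTI (Z k) (measurable_set1 r)). Qed.

Lemma measurable_weighted_block m n : measurable_fun setT (weighted_block m n).
Proof.
by apply: measurable_sum => k; apply: measurable_funM.
Qed.

Lemma measurable_block_fiber m n (r : R) : measurable [set w | weighted_block m n w = r].
Proof.
by rewrite -[X in measurable X]setTI; exact: (measurable_weighted_block m n measurableT (measurable_set1 r)).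
Qed.

Lemma cylinderS l b :
  cylinder l.+1 b = cylinder l b `&` [set w | Z l.+1 w = (b l.+1)%:R].
Proof.
apply/seteqP; split=> w /=.
  by move=> h; split; [move=> k /andP[k0 kl]; apply: h; rewrite k0 leqW|apply: h; rewrite leqnn].
move=> [h hl] k /andP[k0]; rewrite leq_eqVlt => /predU1P[->//|kl].
by apply: h; rewrite k0.
Qed.

Lemma cylinder0 b : cylinder 0 b = setT.
Proof. by apply/seteqP; split=> w // _ k; case: k. Qed.

Lemma measurable_cylinder l b : measurable (cylinder l b).
Proof.
elim: l => [|l IH]; first by rewrite cylinder0.
by rewrite cylinderS; apply: measurableI => //; exact: measurable_fiber.
Qed.

Lemma prob_fiber k (v : bool) : (0 < k)%N ->
  P [set w | Z k w = v%:R] = (if v then k%:R^-1 else 1 - k%:R^-1)%:E.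
Proof. by case: v => k0; [exact: Z1|exact: Z0]. Qed.

Lemma prob_cylinder l b : P (cylinder l b) = (cylinder_mass l b)%:E.
Proof.
pose J : {fset nat} := [fset k in iota 1 l]%fset.
have JE k : (k \in J) = (0 < k <= l)%N by rewrite inE /= mem_iota add1n ltnS.
have -> : cylinder l b = \bigcap_(k in [set` J]) (Z k @^-1` [set (b k)%:R]).
  by apply/seteqP; split=> w h k; [move=> /=; rewrite JE|rewrite -JE]; exact: h.
rewrite Zindep//; last by move=> k /=; rewrite JE => /andP[].
rewrite /cylinder_mass (big_morph EFin (@EFinM R) (erefl 1%:E)).
rewrite (perm_big (index_iota 1 l.+1))/=; last first.
  apply: uniq_perm; rewrite ?fset_uniq ?iota_uniq// => k.
  by rewrite JE mem_index_iota ltnS.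
by apply: eq_big_nat => k /andP[k0 _]; exact: prob_fiber.
Qed.

(** The Z_k are not assumed to take only the values 0 and 1 pointwise, but these two values carry
    the whole mass. *)
Lemma prob_splitting k A : (0 < k)%N -> measurable A ->
  P A = (P (A `&` [set w | Z k w = 0%R]) + P (A `&` [set w | Z k w = 1%R]))%E.
Proof.
move=> k0 mA.
have m0 := measurable_fiber k 0; have m1 := measurable_fiber k 1.
set B0 := [set w | Z k w = 0] in m0 *; set B1 := [set w | Z k w = 1] in m1 *.
have dj : B0 `&` B1 = set0.
  apply/seteqP; split=> w // -[]; rewrite /B0 /B1 /= => -> /eqP.
  by rewrite eq_sym oner_eq0.
have mB : measurable (B0 `|` B1) by exact: measurableU.
have PB : P (B0 `|` B1) = 1%E.
  have P0 : P B0 = (1 - k%:R^-1)%:E := Z0 k0.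
  have P1 : P B1 = (k%:R^-1)%:E := Z1 k0.
  by rewrite measureU//; apply: etrans (f_equal2 +%E P0 P1) _; rewrite -EFinD subrK.
have PC : P (A `\` (B0 `|` B1)) = 0%E.
  apply/eqP; rewrite eq_le measure_ge0 andbT.
  have <- : P (~` (B0 `|` B1)) = 0%E by rewrite probability_setC// PB subee.
  apply: le_measure; rewrite ?inE; [exact: measurableD|exact: measurableC|].
  by move=> w [].
have E1 : P A = (P (A `\` (B0 `|` B1)) + P (A `&` (B0 `|` B1)))%E.
  exact: measureDI.
rewrite E1 PC add0e setIUr measureU//; [exact: measurableI|exact: measurableI|].
by rewrite setIACA dj setI0.
Qed.

Lemma weighted_block_cons l n (w : Omega) : (l < n)%N ->
  weighted_block l n w = l.+1%:R * Z l.+1 w + weighted_block l.+1 n w.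
Proof. by move=> ln; rewrite /weighted_block big_ltn. Qed.

(** Descending induction on l, splitting on the value of Z_(l+1). The event E, of probability g, is
    independent of the first m variables; c accumulates the part of the sum already fixed. *)
Lemma prob_cylinder_block (E : set Omega) (g : R) m : measurable E ->
  (forall b, P (cylinder m b `&` E) = (cylinder_mass m b * g)%:E) ->
  forall l c i b, (l <= m)%N ->
    P (cylinder l b `&` [set w | c%:R + weighted_block l m w = i%:R] `&` E) =
    (cylinder_mass l b * (F l m * 'X^c)`_i * g)%:E.
Proof.
move=> mE Eg l c i b lm.
elim: {l}(m - l)%N {-2}l (erefl (m - l)%N) lm c b => [|t IH] l tE lm c b.
  have -> : l = m by lia.
  rewrite pgfnn mul1r coefXn.
  have -> : [set w | c%:R + weighted_block m m w = i%:R] = if i == c then setT else set0.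
    rewrite /weighted_block; under eq_set do rewrite big_geq// addr0.
    case: eqVneq => [->|ic]; apply/seteqP; split=> w //= /esym/eqP.
    by rewrite eqr_nat (negbTE ic).
  case: eqVneq => ic; first by rewrite setIT mulr1.
  by rewrite setI0 set0I measure0 mulr0 mul0r.
have lm' : (l < m)%N by lia.
have tE' : (m - l.+1)%N = t by lia.
pose u v := fun k => if k == l.+1 then v else b k.
have uC v : cylinder l.+1 (u v) = cylinder l b `&` [set w | Z l.+1 w = v%:R].
  rewrite cylinderS {2}/u eqxx; congr (_ `&` _).
  by apply/seteqP; split=> w h k kl; move: (h k kl); rewrite /u ltn_eqF//; case/andP: kl.
have uM v : cylinder_mass l.+1 (u v) =
    cylinder_mass l b * (if v then l.+1%:R^-1 else 1 - l.+1%:R^-1).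
  rewrite /cylinder_mass big_nat_recr//= {2}/u eqxx; congr (_ * _).
  by apply: eq_big_nat => k /andP[_ kl]; rewrite /u ltn_eqF.
have split_v (v : bool) : cylinder l b `&` [set w | c%:R + weighted_block l m w = i%:R]
      `&` E `&` [set w | Z l.+1 w = v%:R] =
    cylinder l.+1 (u v) `&`
      [set w | (v * l.+1 + c)%:R + weighted_block l.+1 m w = i%:R] `&` E.
  rewrite uC; apply/seteqP; split=> w /=.
    move=> [[[wb wi] wE] wv]; split=> //; split=> //.
    by move: wi; rewrite weighted_block_cons// wv natrD natrM mulrC addrCA addrA.
  move=> [[[wb wv] wi] wE]; split=> //; split=> //; split=> //.
  by move: wi; rewrite (weighted_block_cons w lm') wv natrD natrM mulrC addrCA addrA.
rewrite (@prob_splitting l.+1)//; last first.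
  apply: measurableI => //; apply: measurableI; first exact: measurable_cylinder.
  rewrite (_ : [set w | _] = [set w | weighted_block l m w = i%:R - c%:R]).
    exact: measurable_block_fiber.
  by apply/seteqP; split=> w /= h; [rewrite -h addrC addKr|rewrite h addrC subrK].
have -> := split_v false; have -> := split_v true.
rewrite !IH// -EFinD !uM /= mul0n add0n mul1n; congr EFin.
have -> : (F l m * 'X^c)`_i = (1 - l.+1%:R^-1) * (F l.+1 m * 'X^c)`_i +
    l.+1%:R^-1 * (F l.+1 m * 'X^(l.+1 + c))`_i.
  have -> : F l m = pgf_factor R l.+1 * F l.+1 m by rewrite /pgf big_ltn.
  rewrite /pgf_factor mulrDl [(_ + _) * 'X^c]mulrDl coefD -mulrA coefCM -!scalerAl coefZ exprD.
  by congr (_ + _ * _); rewrite [in RHS]mulrCA [in RHS]mulrA.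
by ring.
Qed.

Lemma joint_law m n i j : (m <= n)%N ->
  P ([set w | weighted_block 0 m w = i%:R] `&` [set w | weighted_block m n w = j%:R]) =
  ((F 0 m)`_i * (F m n)`_j)%:E.
Proof.
move=> mn.
have last_block b : P (cylinder m b `&` [set w | weighted_block m n w = j%:R]) =
    (cylinder_mass m b * (F m n)`_j)%:E.
  (* The block lemma is used twice: here, up to n and with the full event, it gives the law of T_n -
     T_m jointly with the first m variables; then, up to m, with that block event as E. *)
  have := @prob_cylinder_block setT 1 n measurableT _ m 0 j b mn.
  rewrite expr0 mulr1 setIT mulr1; under eq_set do rewrite add0r.
  by apply => b'; rewrite setIT mulr1 prob_cylinder.
have := prob_cylinder_block (measurable_block_fiber m n j%:R) last_block 0 i xpredT (leq0n m).
rewrite cylinder0 setTI expr0 mulr1 /cylinder_mass big_geq// mul1r.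
by under eq_set do rewrite add0r.
Qed.

Lemma law n i : P [set w | weighted_block 0 n w = i%:R] = ((F 0 n)`_i)%:E.
Proof.
have := joint_law i 0 (leqnn n); rewrite pgfnn coef1 mulr1 => <-.
congr (P _); apply/seteqP; split=> w //= => [h|[]//].
by split=> //; rewrite /weighted_block big_geq.
Qed.

End joint_law.

(** * Logarithmic averages *)

Section log_averages.
Variable R : realType.
Implicit Types (m n i j k N : nat).

Local Notation H := (series (@harmonic R)).

(** Monotonicity of n exp(-H_n), compared with its value at n = 1. *)
Lemma harmonic_series_le_ln n : (0 < n)%N -> H n <= 1 + ln n%:R.
Proof.
move=> n0; have : euler_prod (R := R) 1 1 <= euler_prod n 1.
  by apply: euler_prod_nondecreasing => //; rewrite ler01 lexx.
have H1 : H 1 = 1 by rewrite seriesEnat/= big_nat1 invr1.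
by rewrite !euler_prod1E// ler_expR ln1 H1; lra.
Qed.

Lemma ln_le_harmonic_series n : ln n%:R <= H n.
Proof.
case: n => [|n]; first by rewrite ln0// seriesEnat/= big_geq.
rewrite -ler_expR lnK ?posrE//; apply: le_trans (harmonic_series_ge_ln _ _).
by rewrite ler_nat.
Qed.

Lemma ln_nat_unbounded (B : R) : exists N0, forall n, (N0 <= n)%N -> B <= ln n%:R.
Proof.
have := ler_norm B; move: (`|B|) (normr_ge0 B) => b b0 Bb.
exists (Num.truncn (expR b)).+1 => n hn.
apply: le_trans Bb _; rewrite -ler_expR lnK ?posrE ?ltr0n; last by apply: leq_trans hn.
by rewrite (le_trans (ltW (truncnS_gt _)))// ler_nat.
Qed.

Lemma ln_nat_ge0 n : 0 <= ln n%:R :> R.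
Proof. by case: n => [|n]; [rewrite ln0|rewrite ln_ge0// ler1n]. Qed.

Lemma cvg_const_div_ln (B : R) : (fun n => B / ln n%:R) @ \oo --> 0.
Proof.
apply/cvgnP_dist => e e0.
have [N0 NP] := ln_nat_unbounded (`|B| / e + 1).
exists N0 => n /NP h; rewrite subr0.
have B0 : 0 <= `|B| / e by rewrite divr_ge0// ltW.
have l0 : 0 < ln n%:R :> R by lra.
rewrite normrM normfV (gtr0_norm l0) ler_pdivrMr// mulrC -ler_pdivrMr//; lra.
Qed.

Lemma log_cesaro (p : R ^nat) (c : R) : (fun n => n%:R * p n) @ \oo --> c ->
  (fun N => (ln N%:R)^-1 * \sum_(1 <= n < N.+1) p n) @ \oo --> c.
Proof.
move=> /cvgnP_dist pc.
(* The mean splits into the error against c/n, the gap between H and ln, and c. The quotient of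
   logarithms is kept because it is 0, not 1, for N <= 1. *)
suff h : (fun N => (ln N%:R)^-1 * (\sum_(1 <= n < N.+1) p n - c * H N)
    + c * ((H N - ln N%:R) / ln N%:R) + c * (ln N%:R / ln N%:R)) @ \oo --> 0 + c * 0 + c * 1.
  rewrite add0r mulr0 add0r mulr1 in h.
  by apply: eq_cvgn h => N; ring.
have lnn : (fun N => ln N%:R / ln N%:R : R) @ \oo --> (1 : R).
  apply/cvgnP_dist => e e0; have [N0 NP] := ln_nat_unbounded 1.
  by exists N0 => n /NP h; rewrite divff ?subrr ?normr0 ?ltW// gt_eqF//; lra.
have Hln : (fun N => (H N - ln N%:R) / ln N%:R) @ \oo --> (0 : R).
  apply/cvgnP_dist => e e0.
  have [N0 NP] := (cvgnP_dist _ _).1 (cvg_const_div_ln 1) e e0.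
  have [N1 NP1] := ln_nat_unbounded 1.
  exists (maxn (maxn N0 1) N1) => n; rewrite !geq_max => /andP[/andP[n0 n1] n2].
  have l0 := NP1 n n2.
  have li : 0 < (ln n%:R)^-1 :> R by rewrite invr_gt0; lra.
  have := NP n n0; rewrite !subr0 mul1r (gtr0_norm li) => le.
  apply: le_trans le; rewrite normrM (gtr0_norm li) (ler_piMl (ltW li))//.
  have := harmonic_series_le_ln n1; have := ln_le_harmonic_series n.
  by move=> *; rewrite ler_norml; lra.
apply: cvgD; last exact: cvgMl_tmp.
apply: cvgD; last exact: cvgMl_tmp.
apply/cvgnP_dist => e e0.
have [N0 NP] := pc (e / 4) (divr_gt0 e0 (ltr0Sn _ 3)).
pose B := \sum_(1 <= n < N0.+1) `|p n - c / n%:R|.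
have [N1 NP1] := (cvgnP_dist _ _).1 (cvg_const_div_ln B) (e / 2) (divr_gt0 e0 (ltr0Sn _ 1)).
have [N2 NP2] := ln_nat_unbounded 1.
exists (maxn (maxn N0.+1 N1) N2) => N; rewrite !geq_max => /andP[/andP[n0 n1] n2].
have l1 := NP2 N n2.
have li : 0 < (ln N%:R)^-1 :> R by rewrite invr_gt0; lra.
rewrite subr0 normrM (gtr0_norm li).
have -> : \sum_(1 <= n < N.+1) p n - c * H N = \sum_(1 <= n < N.+1) (p n - c / n%:R).
  by rewrite sumrB -mulr_sumr seriesEnat/=; congr (_ - _ * _); rewrite [RHS]big_add1.
have split : `|\sum_(1 <= n < N.+1) (p n - c / n%:R)| <= B + e / 4 * (1 + ln N%:R).
  apply: le_trans (ler_norm_sum _ _ _) _.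
  rewrite (@big_cat_nat _ _ _ N0.+1)//=; last by rewrite ltnW.
  rewrite lerD2l; apply: (@le_trans _ _ (e / 4 * H N)); last first.
    by rewrite ler_wpM2l ?divr_ge0 ?(ltW e0)// harmonic_series_le_ln// (leq_trans _ n0).
  rewrite seriesEnat/= mulr_sumr.
  apply: (@le_trans _ _ (\sum_(1 <= n < N.+1) e / 4 * n%:R^-1)); last by rewrite big_add1.
  rewrite [leRHS](@big_cat_nat _ _ _ N0.+1)//=; last by rewrite ltnW.
  apply: le_trans (_ : \sum_(N0.+1 <= n < N.+1) e / 4 * n%:R^-1 <= _).
    apply: ler_sum_nat => n /andP[Nn nN].
    have nn : 0 < n%:R :> R by rewrite ltr0n (leq_trans _ Nn).
    rewrite ler_pdivlMr//; apply: le_trans (NP n (ltnW Nn)).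
    rewrite -[X in _ * X <= _](gtr0_norm nn) -normrM mulrBl divfK ?gt_eqF//.
    by rewrite mulrC.
  rewrite lerDr sumr_ge0// => n _; rewrite mulr_ge0 ?divr_ge0// ltW//.
have hB : B / ln N%:R <= e / 2.
  by apply: le_trans (ler_norm _) _; have := NP1 N n1; rewrite subr0.
apply: le_trans (ler_wpM2l (ltW li) split) _.
rewrite mulrDr [_ * B]mulrC mulrCA.
have : (ln N%:R)^-1 * (1 + ln N%:R) <= 2 :> R.
  by rewrite mulrC ler_pdivrMr; lra.
have e4 : 0 <= e / 4 by rewrite divr_ge0// ltW.
move=> /(ler_wpM2l e4); lra.
Qed.

Lemma nat_bracket (phi : nat -> nat) J N : (forall j, (j <= phi j)%N) ->
  (phi J <= N)%N -> exists2 j, (J <= j)%N & (phi j <= N < phi j.+1)%N.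
Proof.
move=> phij JN.
have [t] : exists t, (N < phi (J + t)%N)%N.
  by exists N.+1; apply: leq_trans (phij _); rewrite addnS ltnS leq_addl.
elim: t => [|t IH] Nt; first by move: Nt; rewrite addn0 ltnNge JN.
have [lt|ge] := ltnP N (phi (J + t)%N); first exact: IH.
by exists (J + t)%N; [exact: leq_addr|rewrite ge -addnS].
Qed.

(** For phi j <= n < phi (j + 1), monotonicity puts s n / l n between s (phi j) / l (phi (j + 1))
    and s (phi (j + 1)) / l (phi j), which have the same limit. *)
Lemma cvg_ratio_interpolation (s l : R ^nat) (phi : nat -> nat) (c : R) :
  nondecreasing_seq s -> nondecreasing_seq l -> (forall n, 0 <= s n) ->
  (forall j, (j <= phi j)%N) -> (forall j, 0 < l (phi j)) ->
  (fun j => l (phi j) / l (phi j.+1)) @ \oo --> (1 : R) ->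
  (fun j => s (phi j) / l (phi j)) @ \oo --> c ->
  (fun n => s n / l n) @ \oo --> c.
Proof.
move=> s_nd l_nd s0 phij l0 q1 rc.
have lo : (fun j => s (phi j) / l (phi j.+1)) @ \oo --> c * 1.
  apply: eq_cvgn (cvgM rc q1) => j.
  by rewrite /= mulrA divfK// gt_eqF.
have up : (fun j => s (phi j.+1) / l (phi j)) @ \oo --> c * 1^-1.
  have rc' : (fun j => s (phi j.+1) / l (phi j.+1)) @ \oo --> c.
    by rewrite (cvg_shiftS (fun j => s (phi j) / l (phi j))).
  have q' : (fun j => (l (phi j) / l (phi j.+1))^-1) @ \oo --> (1 : R)^-1.
    by apply: cvgV => //; rewrite oner_eq0.
  apply: eq_cvgn (cvgM rc' q') => j.
  by rewrite /= invf_div mulrA divfK// gt_eqF.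
rewrite mulr1 in lo; rewrite invr1 mulr1 in up.
apply/cvgnP_dist => e e0.
have [J1 JP1] := (cvgnP_dist _ _).1 lo e e0.
have [J2 JP2] := (cvgnP_dist _ _).1 up e e0.
exists (phi (maxn J1 J2)) => n /(nat_bracket phij)[j].
rewrite geq_max => /andP[j1 j2] /andP[jn nj].
have ln0 : 0 < l n by apply: lt_le_trans (l0 j) (l_nd _ _ jn).
have /ler_normlP[h1 _] := JP1 j j1.
have /ler_normlP[_ h2] := JP2 j j2.
have a1 : s (phi j) / l (phi j.+1) <= s n / l n.
  apply: ler_pM => //; first by rewrite invr_ge0 ltW.
    exact: s_nd.
  by rewrite lef_pV2 ?posrE//; apply: l_nd; exact: ltnW.
have a2 : s n / l n <= s (phi j.+1) / l (phi j).
  apply: ler_pM => //; first by rewrite invr_ge0 ltW.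
    by apply: s_nd; exact: ltnW.
  by rewrite lef_pV2 ?posrE//; exact: l_nd.
by rewrite ler_norml; lra.
Qed.

End log_averages.

(** * Almost sure convergence *)

Section second_moment.
Context d (Omega : measurableType d) (R : realType) (P : probability Omega R).
Variables (A : nat -> set Omega) (p : R ^nat) (c : nat -> nat -> R).
Hypothesis mA : forall n, measurable (A n).
Hypothesis PA : forall n, (0 < n)%N -> P (A n) = (p n)%:E.
Hypothesis PAA : forall m n, (0 < m)%N -> (m < n)%N ->
  (P (A m `&` A n) <= (p m * p n + c m n)%:E)%E.

Definition count_events N (w : Omega) : R := \sum_(1 <= n < N.+1) \1_(A n) w.

Lemma indic_Lfun2 (B : set Omega) : measurable B -> (\1_B : Omega -> R) \in Lfun P 2%:E.
Proof.
move=> mB; rewrite inE/=; apply/andP; split; rewrite inE//=.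
rewrite /finite_norm unlock poweR_lty//.
rewrite (eq_integral (fun w => (\1_B w)%:E)) => [|w _]; last first.
  rewrite /= !indicE; case: (w \in B); rewrite ?normr1 ?powR1 ?normr0 ?powR0//.
by rewrite integral_indic// setIT ltey_eq fin_num_measure.
Qed.

Lemma indic_Lfun1 (B : set Omega) : measurable B -> (\1_B : Omega -> R) \in Lfun P 1.
Proof. by move=> mB; apply: Lfun_subset12 (indic_Lfun2 mB); rewrite fin_num_measure. Qed.

Lemma count_eventsS N : count_events N.+1 = count_events N \+ \1_(A N.+1).
Proof. by apply/funext => w; rewrite /count_events big_nat_recr. Qed.

Lemma count_events0 : count_events 0 = cst 0.
Proof. by apply/funext => w; rewrite /count_events big_geq. Qed.

Lemma count_events_Lfun2 N : count_events N \in Lfun P 2%:E.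
Proof.
elim: N => [|N IH]; first by rewrite count_events0 Lfun_cst.
have two : (1 <= 2%:E :> \bar R)%E by rewrite lee1n.
have [_ /(_ _ _ IH (indic_Lfun2 (mA N.+1)))] := Lfun_addr_closed P two.
by rewrite count_eventsS.
Qed.

Lemma covariance_indic (B C : set Omega) : measurable B -> measurable C ->
  covariance P \1_B \1_C = (P (B `&` C) - P B * P C)%E.
Proof.
move=> mB mC; have mBC : measurable (B `&` C) by exact: measurableI.
have BC : (\1_B * \1_C)%R = \1_(B `&` C) :> (Omega -> R) by rewrite indicI.
rewrite covarianceE ?BC ?indic_Lfun1//.
by rewrite !expectation_indic.
Qed.

Lemma expectation_count_events N : 'E_P[count_events N]%E = (\sum_(1 <= n < N.+1) p n)%:E.
Proof.
elim: N => [|N IH].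
  rewrite big_geq// count_events0 ?expectation_cst//.
rewrite count_eventsS expectationD ?indic_Lfun1//.
  by rewrite IH expectation_indic// PA// [in RHS]big_nat_recr//= EFinD.
by apply: Lfun_subset12 (count_events_Lfun2 N); rewrite fin_num_measure.
Qed.

Lemma covariance_count_events_le N n : (N < n)%N ->
  (covariance P (count_events N) \1_(A n) <= (\sum_(1 <= m < N.+1) c m n)%:E)%E.
Proof.
elim: N => [|N IH] Nn.
  rewrite big_geq// count_events0 ?covariance_cst_l//.
rewrite count_eventsS covarianceDl ?count_events_Lfun2 ?indic_Lfun2//.
rewrite big_nat_recr//= EFinD; apply: leeD; first exact/IH/ltnW.
rewrite covariance_indic// !PA//; last exact: ltn_trans Nn.
by rewrite -EFinM leeBlDr// -EFinD addrC PAA.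
Qed.

(** Induction on N: the new indicator has variance at most p, and its covariance with the count so
    far is at most the sum of the c. *)
Lemma variance_count_events_le N :
  ('V_P[count_events N] <=
    (\sum_(1 <= n < N.+1) (p n + 2 * \sum_(1 <= m < n) c m n))%:E)%E.
Proof.
elim: N => [|N IH].
  rewrite big_geq// count_events0 ?variance_cst//.
rewrite count_eventsS varianceD ?count_events_Lfun2 ?indic_Lfun2//.
rewrite big_nat_recr//= [leRHS]EFinD -addeA; apply: leeD => //.
rewrite [leRHS]EFinD; apply: leeD.
  rewrite /variance covariance_indic// setIid PA// -EFinM -EFinB lee_fin.
  by rewrite gerBl mulr_ge0// -lee_fin -PA// measure_ge0.
by rewrite [leRHS]EFinM lee_pmul2l// covariance_count_events_le.
Qed.

Lemma count_events_chebyshev N (e V : R) : 0 < e ->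
  ('V_P[count_events N] <= V%:E)%E ->
  (P [set w | (e <= `|count_events N w - \sum_(1 <= n < N.+1) p n|)%R]
    <= (V / e ^+ 2)%:E)%E.
Proof.
move=> e0 VN; have mS := sub_Lfun_mfun (count_events_Lfun2 N).
pose X : {RV P >-> R} := mfun_Sub mS.
have := chebyshev X e0.
have -> : (X : Omega -> R) = count_events N by [].
rewrite expectation_count_events/= => /le_trans; apply.
rewrite mulrC EFinM lee_pmul2l//; first by rewrite lte_fin invr_gt0 exprn_gt0.
Qed.

End second_moment.

(** * From a logarithmic variance bound to almost sure convergence *)

Section almost_sure.
Context d (Omega : measurableType d) (R : realType) (P : probability Omega R).

Lemma sum_inv_sqr_le n : \sum_(0 <= j < n) (j.+1%:R ^+ 2)^-1 <= 2 :> R.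
Proof.
(* The strengthened bound telescopes: 1/x^2 <= 2/x - 2/(x + 1) for x >= 1. *)
suff : \sum_(0 <= j < n) (j.+1%:R ^+ 2)^-1 <= 2 - 2 / n.+1%:R :> R.
  move=> h; apply: le_trans h _; rewrite gerBl divr_ge0//.
elim: n => [|n IH]; first by rewrite big_geq// divr1 subrr.
rewrite big_nat_recr//=; apply: le_trans (lerD IH (lexx _)) _.
rewrite -(natr1 n.+1); have : 1 <= n.+1%:R :> R by rewrite ler1n.
move: (n.+1%:R) => x x1; rewrite -subr_ge0.
rewrite [leRHS](_ : _ = (x - 1) / (x ^+ 2 * (x + 1))); last by field; lra.
by rewrite divr_ge0 ?mulr_ge0 ?exprn_ge0//; lra.
Qed.

Lemma nneseries_lt_pinfty (u : (\bar R)^nat) (C : R) : 0 <= C ->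
  (forall j, 0 <= u j)%E ->
  (forall j, u j <= (C * (j.+1%:R ^+ 2)^-1)%:E)%E ->
  (\sum_(j <oo) u j < +oo)%E.
Proof.
move=> C0 u0 uC; apply: (@le_lt_trans _ _ (C * 2)%:E); last by rewrite ltry.
apply: lime_le; first exact: is_cvg_nneseries.
apply: nearW => n; apply: (@le_trans _ _ (\sum_(0 <= j < n) (C * (j.+1%:R ^+ 2)^-1)%:E)%E).
  exact: lee_sum.
by rewrite sumEFin lee_fin -mulr_sumr ler_wpM2l// sum_inv_sqr_le.
Qed.

Lemma nondecreasing_ln_nat : nondecreasing_seq (fun n => ln n%:R : R).
Proof.
move=> m n mn; case: m mn => [_|m mn]; first by rewrite ln0// ln_nat_ge0.
by rewrite ler_ln ?posrE ?ltr0n ?ler_nat//; exact: leq_trans mn.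
Qed.

(* Sparse enough for Borel-Cantelli with a logarithmic variance, yet with
   ln (phi j) / ln (phi j.+1) -> 1. *)
Let phi j : nat := (2 ^ (j.+1 ^ 4))%N.

Let ln_phi j : ln (phi j)%:R = j.+1%:R ^+ 4 * ln 2 :> R.
Proof. by rewrite /phi natrX lnXn// -[LHS]mulr_natl natrX. Qed.

Let ln2_gt0 : 0 < ln 2 :> R.
Proof. by rewrite ln_gt0// ltr1n. Qed.

Let phi_ge j : (j <= phi j)%N.
Proof.
apply: leq_trans (ltnW (ltn_expl _ (ltnSn 1))).
by apply: leq_trans (leqnSn j) _; rewrite -{1}[j.+1]expn1 leq_pexp2l//.
Qed.

Let ln_phi_gt0 j : 0 < ln (phi j)%:R :> R.
Proof. by rewrite ln_phi mulr_gt0// exprn_gt0. Qed.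

Let cvg_ln_phi_ratio : (fun j => ln (phi j)%:R / ln (phi j.+1)%:R) @ \oo --> (1 : R).
Proof.
have h : (fun j => (1 - j.+2%:R^-1) ^+ 4) @ \oo --> ((1 - 0) ^+ 4 : R).
  apply: (@cvg_comp _ _ _ (fun j => 1 - j.+2%:R^-1) (fun x : R => x ^+ 4)); last exact: exprn_continuous.
  apply: cvgB; first exact: cvg_cst.
  by rewrite (cvg_shiftS (fun j => j.+1%:R^-1 : R)); exact: cvg_harmonic.
rewrite subr0 expr1n in h; apply: eq_cvgn h => j.
rewrite !ln_phi -(natr1 j.+1); have := ln2_gt0; have : 0 < j.+1%:R :> R by [].
by move: (j.+1%:R) (ln 2) => x a x0 a0; field; lra.
Qed.

Variables (A : nat -> set Omega) (p : R ^nat).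
Hypothesis mA : forall n, measurable (A n).
Hypothesis PA : forall n, (0 < n)%N -> P (A n) = (p n)%:E.

Lemma ae_log_count_events (B L : R) :
  (forall N, (0 < N)%N -> 'V_P[count_events R A N] <= (B * (1 + ln N%:R))%:E)%E ->
  (fun N => (ln N%:R)^-1 * \sum_(1 <= n < N.+1) p n) @ \oo --> L ->
  {ae P, forall w, (fun N => (ln N%:R)^-1 * count_events R A N w) @ \oo --> L}.
Proof.
move=> VB mean.
pose S := count_events R A.
pose mu N := \sum_(1 <= n < N.+1) p n.
(* This threshold is o(ln (phi j)), and since ln (phi j) grows like (j + 1)^4, Chebyshev's bound is
   still O((j + 1)^-2), which is summable. *)
pose e j : R := ln (phi j)%:R / j.+1%:R.
have e0 j : 0 < e j by rewrite divr_gt0.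
pose E j := [set w | e j <= `|S (phi j) w - mu (phi j)|].
have mE j : measurable (E j).
  have mS : measurable_fun setT (fun w => `|S (phi j) w - mu (phi j)|).
    apply: measurableT_comp => //; apply: measurable_funB => //.
    by have := sub_Lfun_mfun (count_events_Lfun2 P mA (phi j)); rewrite inE.
  have -> : E j = (fun w => `|S (phi j) w - mu (phi j)|) @^-1` `[e j, +oo[.
    by apply/seteqP; split=> w /=; rewrite in_itv/= andbT.
  by rewrite -[X in measurable X]setTI; exact: mS.
have B0 : 0 <= B.
  have := VB 1%N isT; rewrite ln1 addr0 mulr1 -lee_fin; apply: le_trans.
  exact: variance_ge0.
have PE : P (lim_sup_set E) = 0%E.
  apply: lim_sup_set_cvg0 => //.
  pose a := ln 2 : R; have a0 : 0 < a := ln2_gt0.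
  apply: (@nneseries_lt_pinfty _ (B * (a^-1 + 1) / a)) => [|j|j].
  - by rewrite divr_ge0 ?mulr_ge0 ?addr_ge0 ?invr_ge0// ltW.
  - exact: measure_ge0.
  have := @count_events_chebyshev _ _ _ P A p mA PA (phi j) (e j) _ (e0 j) (VB (phi j) _).
  rewrite /phi expn_gt0 => /(_ isT) /le_trans; apply.
  rewrite lee_fin -/(phi j) /e ln_phi -/a.
  have x1 : 1 <= j.+1%:R :> R by rewrite ler1n.
  move: (j.+1%:R) x1 => x x1; rewrite -subr_ge0.
  have x4 : 1 <= x ^+ 4 by rewrite exprn_ege1.
  rewrite [leRHS](_ : _ = B * (x ^+ 4 - 1) / (a ^+ 2 * x ^+ 6)); last by field; lra.
  rewrite divr_ge0 ?mulr_ge0 ?exprn_ge0//; lra.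
exists (lim_sup_set E); split => //.
  by apply: bigcap_measurable => // k _; exact: bigcup_measurable.
move=> w /= nQ; apply: contrapT => nE; apply: nQ.
have [n0 nP] : exists n0, forall j, (n0 <= j)%N -> `|S (phi j) w - mu (phi j)| < e j.
  apply: contrapT => /forallNP h; apply: nE => n _.
  have /existsNP[j /not_implyP[nj /negP]] := h n; rewrite -leNgt => ej.
  by exists j.
suff h : (fun N => S N w / ln N%:R) @ \oo --> L.
  by apply: eq_cvgn h => N; rewrite mulrC.
apply: (@cvg_ratio_interpolation _ _ (fun N => ln N%:R) phi) => //.
- apply/nondecreasing_seqP => N; rewrite /S count_eventsS /= lerDl.
  by rewrite indicE.
- exact: nondecreasing_ln_nat.
- by move=> N; rewrite /S /count_events sumr_ge0// => i _; rewrite indicE.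
have d0 : (fun j => S (phi j) w / ln (phi j)%:R - mu (phi j) / ln (phi j)%:R) @ \oo --> (0 : R).
  apply: norm_cvg0; apply: (@squeeze_cvgr _ _ _ _ (cst 0) (fun j => j.+1%:R^-1)).
  - exists n0 => // j /= /nP; rewrite normr_ge0/= -mulrBl normrM normfV.
    rewrite (gtr0_norm (ln_phi_gt0 j)) ler_pdivrMr// mulrC => /ltW.
    exact.
  - exact: cvg_cst.
  - exact: cvg_harmonic.
have mphi : (fun j => mu (phi j) / ln (phi j)%:R) @ \oo --> L.
  apply/cvgnP_dist => r /((cvgnP_dist _ _).1 mean)[N0 NP].
  by exists N0 => j Nj; rewrite mulrC; apply/NP/(leq_trans Nj).
rewrite -[L]add0r; apply: eq_cvgn (cvgD d0 mphi) => j.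
by rewrite /= subrK.
Qed.

End almost_sure.

(** * The events T_n = kappa_n *)

Section kappa.
Context d (Omega : measurableType d) (R : realType) (P : probability Omega R)
  (Z : nat -> {RV P >-> R}).
Hypothesis Zindep : independent_RVs [set k : nat | (1 <= k)%N] Z.
Hypothesis Z1 : forall k : nat, (1 <= k)%N -> P [set w | Z k w = 1] = (k%:R^-1)%:E.
Hypothesis Z0 : forall k : nat, (1 <= k)%N -> P [set w | Z k w = 0] = (1 - k%:R^-1)%:E.
Variables (x : R) (kappa : nat -> int).
Hypothesis x_gt0 : 0 < x.
Hypothesis kappa_incr : forall m n : nat, (1 <= m)%N -> (m < n)%N -> kappa m < kappa n.
Hypothesis kappa_lim : (fun n : nat => (kappa n)%:~R / n%:R : R) @ \oo --> x.

Local Notation F := (pgf R).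

Definition hit_event n : set Omega := [set v | weighted_sum Z n v = (kappa n)%:~R].

(** A negative value of [kappa n] is attained with probability 0. *)
Definition hit_prob n : R := if kappa n is Posz b then (F 0 n)`_b else 0.

Lemma measurable_hit_event n : measurable (hit_event n).
Proof. exact: (measurable_block_fiber Z 0 n (kappa n)%:~R). Qed.

Lemma prob_hit_event n : P (hit_event n) = (hit_prob n)%:E.
Proof.
rewrite /hit_event /hit_prob; case: (kappa n) => b; first exact: (law Zindep Z1 Z0).
(* For [kappa n] = -(b + 1) the event reads (b + 1) + T_n = 0. With offset b + 1 its probability is
   coefficient 0 of a multiple of X^(b+1), hence 0. *)
have := @prob_cylinder_block _ _ _ P Z Z1 Z0 setT 1 n measurableT _ 0 b.+1 0 xpredT (leq0n n).
rewrite coefMXn mulr0 mul0r cylinder0 setTI setIT => <-; last first.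
  by move=> b'; rewrite setIT mulr1 (prob_cylinder Zindep Z1 Z0).
congr (P _); apply/seteqP; split=> w /=; rewrite NegzE /weighted_sum -/(weighted_block Z 0 n w).
  by move=> ->; rewrite rmorphN/= subrr.
by rewrite rmorphN/= => /eqP; rewrite addrC addr_eq0 => /eqP.
Qed.

Lemma hit_prob_ge0 n : 0 <= hit_prob n.
Proof. by rewrite /hit_prob; case: (kappa n) => // b; exact: pgf_coef_ge0. Qed.

Lemma hit_prob_le n : (0 < n)%N -> hit_prob n <= 3 / n%:R.
Proof.
move=> n0; rewrite ler_pdivlMr ?ltr0n// mulrC /hit_prob.
by case: (kappa n) => b; [exact: pgf0_coef_le3|rewrite mulr0].
Qed.

Lemma kappa_le_linear : exists2 K, x <= K%:R &
  forall n, (0 < n)%N -> (kappa n)%:~R <= K%:R * n%:R :> R.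
Proof.
have [N NP] := (cvgnP_dist _ _).1 kappa_lim 1 ltr01.
pose N1 := N.+1.
pose t := (Num.truncn (x + 1)).+1.
have xt : x + 1 <= t%:R by rewrite ltW// truncnS_gt.
(* The limit bounds [kappa n] by t n for large n; the earlier values are at most [kappa N1] by
   monotonicity. *)
exists (t + `|kappa N1|)%N; first by rewrite natrD; have : 0 <= `|kappa N1|%:R :> R by []; lra.
move=> n n0; have n0' : 0 < n%:R :> R by rewrite ltr0n.
have [Nn|nN] := leqP N1 n.
  have /ler_normlP[_] := NP n (ltnW Nn); rewrite lerBlDl => h.
  rewrite -ler_pdivrMr//; apply: le_trans h _; rewrite natrD.
  by have : 0 <= `|kappa N1|%:R :> R by []; lra.
apply: (@le_trans _ _ (kappa N1)%:~R); first by rewrite ler_int ltW// kappa_incr.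
apply: (@le_trans _ _ `|kappa N1|%:R).
  by rewrite natr_absz ler_int ler_norm.
apply: (@le_trans _ _ (t + `|kappa N1|)%:R); first by rewrite ler_nat leq_addl.
by rewrite ler_peMr// ler1n.
Qed.

Lemma kappa_ge_linear : exists N, forall n, (N <= n)%N -> x / 2 * n%:R <= (kappa n)%:~R :> R.
Proof.
have [N NP] := (cvgnP_dist _ _).1 kappa_lim (x / 2) (divr_gt0 x_gt0 (ltr0Sn _ 1)).
exists N.+1 => n Nn; have n0' : 0 < n%:R :> R by rewrite ltr0n (leq_trans _ Nn).
have /ler_normlP[h _] := NP n (ltnW Nn).
by rewrite -ler_pdivlMr//; lra.
Qed.

Lemma prob_hit_event2_le : exists2 C : R, 0 <= C &
  forall m n, (0 < m)%N -> (m < n)%N ->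
  (P (hit_event m `&` hit_event n) <=
    (hit_prob m * hit_prob n + C * ((n%:R ^+ 2)^-1 + (m%:R ^+ 2 * n%:R)^-1))%:E)%E.
Proof.
have [K _ KP] := kappa_le_linear; have [N NP] := kappa_ge_linear.
pose C1 : R := 3 * (6 * K%:R + 12) / (x / 2).
have C10 : 0 <= C1 by rewrite divr_ge0 ?mulr_ge0 ?addr_ge0 ?divr_ge0// ltW.
exists (C1 + N%:R ^+ 2); first by rewrite addr_ge0// exprn_ge0.
move=> m n m0 mn.
have n0 : (0 < n)%N by exact: ltn_trans mn.
have mI : measurable (hit_event m `&` hit_event n).
  by apply: measurableI; exact: measurable_hit_event.
have r0 : 0 <= (m%:R ^+ 2 * n%:R)^-1 :> R by rewrite invr_ge0 mulr_ge0// exprn_ge0.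
have q0 : 0 <= (n%:R ^+ 2)^-1 :> R by rewrite invr_ge0 exprn_ge0.
have pp0 : 0 <= hit_prob m * hit_prob n by rewrite mulr_ge0// hit_prob_ge0.
(* For n < N the bound is trivial, as the constant contains N^2 and N^2 / n^2 >= 1. For larger n,
   [pgf_cov_bound] applies with A = K and c = x/2. *)
have [nN|Nn] := ltnP n N.
  apply: le_trans (probability_le1 P mI) _; rewrite lee_fin mulrDl -[leLHS]add0r.
  apply: lerD => //; rewrite -[leLHS]add0r; apply: lerD; first by rewrite mulr_ge0// addr_ge0.
  rewrite mulrDr -[leLHS]addr0; apply: lerD; last by rewrite mulr_ge0// exprn_ge0.
  by rewrite ler_pdivlMr ?exprn_gt0 ?ltr0n// mul1r ler_sqr ?nnegrE// ler_nat ltnW.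
have kn : 0 < (kappa n)%:~R :> R.
  by apply: lt_le_trans (NP n Nn); rewrite mulr_gt0 ?divr_gt0 ?ltr0n.
have kmn := kappa_incr m0 mn; have := NP n Nn; have := KP m m0.
have : hit_prob m = if kappa m is Posz a then (F 0 m)`_a else 0 by [].
have : hit_prob n = if kappa n is Posz b then (F 0 n)`_b else 0 by [].
case En: (kappa n) kn kmn => [b|b] kn kmn; last by move: kn; rewrite ltr0z.
case Em: (kappa m) kmn => [a|a] kmn pn pm Ka cb; last first.
  apply: (@le_trans _ _ (P (hit_event m))).
    by apply: le_measure; rewrite ?inE//; exact: measurable_hit_event.
  rewrite prob_hit_event lee_fin {1}pm addr_ge0// mulr_ge0 ?addr_ge0// exprn_ge0//.
have ab : (a < b)%N by [].
have -> : hit_event m `&` hit_event n =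
    [set w | weighted_block Z 0 m w = a%:R] `&` [set w | weighted_block Z m n w = (b - a)%:R].
  have wsE w : weighted_sum Z n w = weighted_block Z 0 m w + weighted_block Z m n w.
    by rewrite /weighted_sum /weighted_block (@big_cat_nat _ _ _ m.+1)//= ltnS ltnW.
  rewrite /hit_event En Em; apply/seteqP; split=> w /=.
    rewrite wsE => -[h1 h2]; split=> //; rewrite natrB ?(ltnW ab)//.
    by rewrite -[a%:R]h1 -[b%:R]h2 addrC addKr.
  by rewrite wsE => -[h1 h2]; split=> //; rewrite h1 h2 -natrD subnKC// ltnW.
rewrite (joint_law Zindep Z1 Z0)//; last exact: ltnW.
rewrite lee_fin pn pm -lerBlDl.
apply: le_trans (pgf_cov_bound _ _ m0 (ltnW mn) ab Ka cb) _ => //; first by rewrite divr_gt0.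
by rewrite ler_wpM2r ?addr_ge0// lerDl exprn_ge0.
Qed.

Lemma variance_hits_le : exists B, forall N, (0 < N)%N ->
  ('V_P[count_events R hit_event N] <= (B * (1 + ln N%:R))%:E)%E.
Proof.
have [C C0 CP] := prob_hit_event2_le.
(* The probability is at most 3/n, and the covariances over m < n sum to at most C (1/n + 2/n),
   counted twice. *)
exists (3 + 6 * C) => N N0.
apply: le_trans (variance_count_events_le measurable_hit_event (fun n _ => prob_hit_event n) CP N) _.
rewrite lee_fin; apply: (@le_trans _ _ ((3 + 6 * C) * series (@harmonic R) N)).
  rewrite seriesEnat/= mulr_sumr.
  have -> : \sum_(0 <= i < N) (3 + 6 * C) / i.+1%:R =
      \sum_(1 <= n < N.+1) (3 + 6 * C) / n%:R :> R by rewrite [RHS]big_add1.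
  apply: ler_sum_nat => n /andP[n0 _].
  have n0' : 0 < n%:R :> R by rewrite ltr0n.
  rewrite [leRHS]mulrDl; apply: lerD; first exact: hit_prob_le.
  rewrite -mulr_sumr big_split/=.
  have s1 : \sum_(1 <= m < n) (n%:R ^+ 2)^-1 <= n%:R^-1 :> R.
    rewrite sumr_const_nat -[leLHS]mulr_natl expr2 invfM mulrA ler_piMl//.
    by rewrite ler_pdivrMr// mul1r ler_nat leq_subr.
  have s2 : \sum_(1 <= m < n) (m%:R ^+ 2 * n%:R)^-1 <= 2 / n%:R :> R.
    under eq_bigr do rewrite invfM; rewrite -mulr_suml ler_wpM2r ?invr_ge0//.
    by rewrite big_add1; exact: sum_inv_sqr_le.
  have := ler_wpM2l C0 (lerD s1 s2); lra.
rewrite ler_wpM2l//; first by rewrite addr_ge0// mulr_ge0.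
exact: harmonic_series_le_ln.
Qed.

Lemma cvg_hit_prob (rho : R -> R) : is_dickman rho ->
  (fun n => n%:R * hit_prob n) @ \oo --> expR (- euler_mascheroni R) * rho x.
Proof.
move=> rhoP; set v := expR _; have v0 : 0 < v by exact: expR_gt0.
have [K xK KP] := kappa_le_linear; have [N NP] := kappa_ge_linear.
have [C C0 CP] := dickman_lipschitz rhoP K%:R.
apply/cvgnP_dist => e e0; have e2 : 0 < e / 2 by rewrite divr_gt0.
have [M MP] := pgf_dickman rhoP K e2.
have vC : 0 <= v * C by rewrite mulr_ge0// ltW.
(* The Lipschitz error is at most v C e / (2 (v C + 1)) <= e/2; the added 1 keeps the denominator
   positive when C = 0. *)
have D0 : 0 < 2 * (v * C + 1) by rewrite mulr_gt0//; lra.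
have [N1 NP1] := (cvgnP_dist _ _).1 kappa_lim _ (divr_gt0 e0 D0).
pose N2 := (Num.truncn (M%:R / (x / 2))).+1.
exists (maxn (maxn N N1) N2) => n; rewrite !geq_max => /andP[/andP[nN n1] n2].
have n0 : (0 < n)%N by exact: leq_trans n2.
have n0' : 0 < n%:R :> R by rewrite ltr0n.
have := NP n nN; have := KP n n0; have := NP1 n n1; rewrite /hit_prob.
case: (kappa n) => b close bK bc; last first.
  have : 0 < x / 2 * n%:R by rewrite mulr_gt0// divr_gt0.
  by move=> /lt_le_trans/(_ bc); rewrite ltr0z.
have Mb : (M <= b)%N.
  rewrite -(ler_nat R); apply: le_trans bc.
  rewrite mulrC -ler_pdivrMr ?divr_gt0//.
  by apply: le_trans (ltW (truncnS_gt _)) _; rewrite ler_nat.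
have bKn : (b <= K * n)%N by rewrite -(ler_nat R) natrM.
have err := MP n b Mb n0 bKn.
have -> : n%:R * (F 0 n)`_b - v * rho x =
    dickman_error rho n b + v * (rho (b%:R / n%:R) - rho x).
  by rewrite /dickman_error -/v; ring.
apply: le_trans (ler_normD _ _) _; rewrite (splitr e); apply: lerD => //.
rewrite normrM gtr0_norm//.
have lip : `|rho (b%:R / n%:R) - rho x| <= C * `|b%:R / n%:R - x|.
  by apply: CP; rewrite ?divr_ge0 ?ler_pdivrMr ?(ltW x_gt0).
apply: le_trans (ler_wpM2l (ltW v0) lip) _; rewrite mulrA.
apply: le_trans (ler_wpM2l vC close) _.
rewrite mulrA ler_pdivrMr// -subr_ge0.
rewrite [leRHS](_ : _ = e); first exact: ltW.
by field.
Qed.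

End kappa.

Theorem theorem2p2 (R : realType) (d : measure_display)
    (Omega : measurableType d) (P : probability Omega R)
    (Z : nat -> {RV P >-> R})
    (Zindep : independent_RVs [set k : nat | (1 <= k)%N] Z)
    (Z1 : forall k : nat, (1 <= k)%N ->
       P [set w | Z k w = 1] = (k%:R^-1)%:E)
    (Z0 : forall k : nat, (1 <= k)%N ->
       P [set w | Z k w = 0] = (1 - k%:R^-1)%:E)
    (rho : R -> R) (rho_dickman : is_dickman rho)
    (x : R) (x_gt0 : 0 < x)
    (kappa : nat -> int)
    (kappa_incr : forall m n : nat, (1 <= m)%N -> (m < n)%N ->
       kappa m < kappa n)
    (kappa_lim : (fun n : nat => (kappa n)%:~R / n%:R : R) @ \oo --> x) :
  {ae P, forall w : Omega,
    (fun N : nat => (ln N%:R)^-1 *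
       \sum_(1 <= n < N.+1)
          \1_[set v | weighted_sum Z n v = (kappa n)%:~R] w)
    @ \oo --> expR (- euler_mascheroni R) * rho x}.
Proof.
have [B VB] := variance_hits_le Zindep Z1 Z0 x_gt0 kappa_incr kappa_lim.
have mean := log_cesaro (cvg_hit_prob x_gt0 kappa_incr kappa_lim rho_dickman).
exact: (ae_log_count_events (measurable_hit_event Z kappa)
  (fun n _ => prob_hit_event Zindep Z1 Z0 kappa n) VB mean).
Qed.
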